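(* Let $k$ be an algebraically closed field of characteristic zero and $C$ a smooth projective curve over $k$ of genus $g\ge2$. Let $u\in k(C)$ have degree $n\ge 2$, with finite branch values $a_1,\dots,a_r\in k$. Suppose that $$u^*(a_j)=e_jF_j,\quad \deg F_j=d_j,\quad e_jd_j=n\quad(1\le j\le r),\qquad u^*(\infty)=e_\infty F_\infty,\quad\deg F_\infty=d_\infty,\quad e_\infty d_\infty=n,$$ with $F_1,\dots,F_r$ and $F_\infty$ reduced effective divisors, and suppose $\gcd(n,d_1,\dots,d_r,d_\infty)=1$. Then the following are equivalent. (i) $k(C)/k(u)$ is Galois with cyclic Galois group. (ii) There are integers $l_1,\dots,l_r$ with $\gcd(n,l_j)=d_j$ for all $j$ and $\gcd(n,l_1+\dots+l_r)=d_\infty$ such that $$D=\frac1n\operatorname{div}\Bigl(\prod_{j=1}^r(u-a_j)^{l_j}\Bigr)$$ is principal. When (ii) holds and $v$ spans $L(-D)$, there is $c\in k^\times$ with $$v^n=c\prod_{j=1}^r(u-a_j)^{l_j},\qquad k(C)=k(u,v).$$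
   Context: For a function $u$ of degree $n$, $u^*(a)$ denotes the fibre divisor of $u:C\to\mathbb P^1$ over $a$; branch values are the values over which $u$ is ramified. $L(D')=\{f\in k(C):\operatorname{div}(f)+D'\ge0\}\cup\{0\}$ denotes the Riemann--Roch space. Under the hypotheses in (ii) the divisor $D$ has integer coefficients. *)

(* Defs.v *)
From mathcomp Require Import all_boot all_order all_algebra.
From mathcomp Require Import boolp.
From mathcomp Require Export mpoly freeg.

Set Implicit Arguments.
Unset Strict Implicit.
Unset Printing Implicit Defensive.

Import Order.TTheory GRing.Theory Num.Theory.

Local Open Scope ring_scope.

(* ------------------------- Field extensions ------------------------------ *)
(* Subfields and subspaces of a field K are predicates K -> Prop.            *)

Section FieldExtensions.

Context (k K : fieldType) (iota : {rmorphism k -> K}).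

(* k(S), the smallest subfield of K containing iota(k) and S. *)
Inductive adjoin (S : seq K) : K -> Prop :=
| adjoin_const c : adjoin S (iota c)
| adjoin_gen s : s \in S -> adjoin S s
| adjoin_sub f h : adjoin S f -> adjoin S h -> adjoin S (f - h)
| adjoin_mul f h : adjoin S f -> adjoin S h -> adjoin S (f * h)
| adjoin_inv f : adjoin S f -> adjoin S f^-1.

Definition has_dim (E V : K -> Prop) (n : nat) : Prop :=
  exists b : 'I_n -> K,
    [/\ forall i, V (b i),
        forall c : 'I_n -> K, (forall i, E (c i)) ->
          \sum_(i < n) c i * b i = 0 -> forall i, c i = 0
      & forall f, V f -> exists c : 'I_n -> K,
          (forall i, E (c i)) /\ f = \sum_(i < n) c i * b i].

Definition is_aut_over (E : K -> Prop) (s : {rmorphism K -> K}) : Prop :=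
  bijective s /\ forall f, E f -> s f = f.

(* K / E is finite, and E is the fixed field of Aut(K / E). *)
Definition is_galois (E : K -> Prop) : Prop :=
  (exists n, has_dim E (fun=> True) n) /\
  forall f, (forall s, is_aut_over E s -> s f = f) -> E f.

(* For K / E finite, Aut(K / E) is finite, so nonnegative powers suffice. *)
Definition has_cyclic_aut_group (E : K -> Prop) : Prop :=
  exists s, is_aut_over E s /\
    forall t, is_aut_over E t -> exists m, t =1 iter m s.

Definition has_trdeg1 : Prop :=
  exists2 t, ~ algebraicOver iota t &
    forall f, exists p : {poly K},
      [/\ p != 0, forall i, adjoin [:: t] p`_i & root p f].

End FieldExtensions.

(* ---------------------- Smooth projective curves ------------------------- *)

(* Closed points of P^N, each given by its unique homogeneous coordinate
   vector whose first nonzero coordinate is 1. *)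
Definition normalized (k : fieldType) (N : nat) (p : 'rV[k]_N.+1) : bool :=
  [exists i, (p 0 i == 1) && [forall j : 'I_N.+1, (j < i)%N ==> (p 0 j == 0)]].

(* F(x), for a polynomial F over k and a point x with coordinates in K. *)
Definition eval_at (k K : fieldType) (iota : {rmorphism k -> K}) (N : nat)
  (x : 'rV[K]_N.+1) (F : {mpoly k[N.+1]}) : K := (map_mpoly iota F).@[x 0].

(* The homogeneous elements of the homogeneous prime ideal of the closed
   subvariety of P^N with generic point x. *)
Definition vanishing_form (k K : fieldType) (iota : {rmorphism k -> K})
  (N : nat) (x : 'rV[K]_N.+1) (F : {mpoly k[N.+1]}) : Prop :=
  (exists d, F \is d.-homog) /\ eval_at iota x F = 0.

Definition on_variety (k K : fieldType) (iota : {rmorphism k -> K})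
  (N : nat) (x : 'rV[K]_N.+1) (p : 'rV[k]_N.+1) : Prop :=
  forall F, vanishing_form iota x F -> F.@[p 0] = 0.

(* Jacobian criterion for a one-dimensional closed subvariety of P^N. *)
Definition smooth_at (k K : fieldType) (iota : {rmorphism k -> K})
  (N : nat) (x : 'rV[K]_N.+1) (p : 'rV[k]_N.+1) : Prop :=
  exists F : 'I_(N - 1) -> {mpoly k[N.+1]},
    (forall i, vanishing_form iota x (F i)) /\
    \rank (\matrix_(i < N - 1, j < N.+1) (mderiv j (F i)).@[p 0]) = (N - 1)%N.

(* An integral closed subvariety of P^N is the same thing as its generic
   point x = (x_0 : ... : x_N), whose coordinates lie in the function field,
   and whose ratios x_j / x_i generate the function field over k.  Its
   homogeneous ideal is spanned by the forms F with F(x) = 0. *)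
Record smooth_projective_curve (k : closedFieldType) := SmoothProjectiveCurve {
  funfield : fieldType;
  const : {rmorphism k -> funfield};
  ambient_dim : nat;
  generic_pt : 'rV[funfield]_ambient_dim.+1;
  generic_pt_neq0 : generic_pt != 0;
  funfield_generated : forall f : funfield, adjoin const
    [seq generic_pt 0 ij.1 / generic_pt 0 ij.2
      | ij : 'I_ambient_dim.+1 * 'I_ambient_dim.+1] f;
  curve_dim1 : has_trdeg1 const;
  curve_smooth : forall p, normalized p -> on_variety const generic_pt p ->
    smooth_at const generic_pt p
}.

Arguments const {k} C : rename.
Arguments generic_pt {k} C : rename.

Section Curve.

Context (k : closedFieldType) (C : smooth_projective_curve k).

Local Notation kC := (funfield C).
Local Notation N := (ambient_dim C).

Definition point : choiceType :=
  {p : 'rV[k]_N.+1 | normalized p && `[< on_variety (const C) (generic_pt C) p >]}.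

Definition coords (P : point) : 'rV[k]_N.+1 := sval P.

(* f = G / H with G, H forms of the same degree, H(P) <> 0 and
   a = G(P) / H(P): the function f is regular at P with value a there. *)
Definition has_value (P : point) (f : kC) (a : k) : Prop :=
  exists d (G H : {mpoly k[N.+1]}),
    [/\ G \is d.-homog, H \is d.-homog, H.@[coords P 0] != 0,
        f = eval_at (const C) (generic_pt C) G
              / eval_at (const C) (generic_pt C) H
      & a = G.@[coords P 0] / H.@[coords P 0]].

Definition regular_at (P : point) (f : kC) : Prop := exists a, has_value P f a.

Definition local_unit (P : point) (f : kC) : Prop :=
  exists2 a, a != 0 & has_value P f a.

(* t generates the maximal ideal of the local ring at P. *)
Definition uniformizer (P : point) (t : kC) : Prop :=
  forall f, has_value P f 0 <-> exists2 h, regular_at P h & f = t * h.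

Definition has_order (P : point) (f : kC) (m : int) : Prop :=
  exists t h, [/\ uniformizer P t, local_unit P h & f = t ^ m * h].

(* The order of vanishing of f at P; it is only meaningful for f != 0, and
   ord P 0 = 0 by convention. *)
Definition ord (P : point) (f : kC) : int :=
  if pselect (exists m, has_order P f m) is left ex then projT1 (cid ex) else 0.

Definition divisor := {freeg point / int}.

Definition is_div (f : kC) (D : divisor) : Prop :=
  forall P, coeff P D = ord P f.

Definition principal (D : divisor) : Prop :=
  exists2 f, f != 0 & is_div f D.

Definition reduced_effective (D : divisor) : Prop :=
  forall P, coeff P D = 0 \/ coeff P D = 1.

Definition is_const (f : kC) : Prop := exists c, f = const C c.

(* L(D) *)
Definition RRspace (D : divisor) (f : kC) : Prop :=
  f = 0 \/ forall P, 0 <= ord P f + coeff P D.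

Definition spans (v : kC) (V : kC -> Prop) : Prop :=
  forall f, V f <-> exists c, f = const C c * v.

(* The genus, as defined in the theory of function fields: the maximum of
   deg A - dim L(A) + 1 over all divisors A. *)
Definition has_genus (g : nat) : Prop :=
  (exists A l, has_dim is_const (RRspace A) l /\ deg A - l%:Z + 1 = g%:Z) /\
  (forall A l, has_dim is_const (RRspace A) l -> deg A - l%:Z + 1 <= g%:Z).

(* --------------- Functions as morphisms to the projective line ----------- *)

Definition ratfuns (u : kC) : kC -> Prop := adjoin (const C) [:: u].

Definition has_degree (u : kC) (n : nat) : Prop :=
  has_dim (ratfuns u) (fun=> True) n.

Definition is_fibre (u : kC) (a : k) (D : divisor) : Prop :=
  forall P, coeff P D = Num.max 0 (ord P (u - const C a)).

Definition is_fibre_at_infty (u : kC) (D : divisor) : Prop :=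
  forall P, coeff P D = Num.max 0 (- ord P u).

Definition finite_branch_value (u : kC) (a : k) : Prop :=
  exists P, 1 < ord P (u - const C a).

End Curve.

(* Main.v *)
(* The Jacobian criterion together with Euler's formula makes the maximal ideal
   of each local ring principal, and transcendence degree one then makes [ord]
   a valuation with residue field [k].  A nonconstant function without poles
   would make every nonzero [L(A)] infinite dimensional, which the existence of
   the genus excludes.

   (i) => (ii): Kummer theory gives [v] with [s v = zeta v] for a generator [s];
   off the branch values the exponents of [v^n] are multiples of [n] and can be
   absorbed in [v], and [D = div v].  With [v^n = (u - b)^l R] and
   [g = gcd(n, l)], the equality [gcd(n, l) = d] amounts to [g] points over [b].
   If there were fewer, the unit [w = v^(n/g) (u - b)^(-l/g)], whose [g]-th power
   is [R], would miss a [g]-th root [eta] of [R(b)] over [b]; then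
   [sum_(i < g) (eta / w)^i / (u - b)] has no pole over [b].  Counting dimensions
   in [L(M u^*(infinity))] shows that, up to a unit at [b], it is integral over
   [k[u]], whereas its trace is [n / (u - b)].

   (ii) => (i): [v^n] is a constant times the product, the orders over the branch
   values show that [v^m] lies in [k(u)] only for [n | m], so [X^n - v^n] is
   irreducible over [k(u)] and [v |-> zeta v] extends to an automorphism. *)

From HB Require Import structures.
Require Import Defs.
From mathcomp Require Import all_boot all_order all_algebra.
From mathcomp Require Import boolp ring zify.
From mathcomp Require cyclic separable cyclotomic.

Set Implicit Arguments.
Unset Strict Implicit.
Unset Printing Implicit Defensive.

Import Order.TTheory GRing.Theory Num.Theory.

Local Open Scope ring_scope.

(** * Local rings of a projective curve *)

(** The delicate point is the number of points in a fibre. Orders at a single point only give that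
    [d] divides [gcd(n, l)]. The converse is proved without transitivity of a Galois group on
    fibres: the global inputs are that a function without poles is constant and that [L] of an
    effective divisor of degree [m] has dimension at most [m + 1]. The function with the forbidden
    trace comes from the factorization [R - R(b) = w^g - eta^g]. Its left side vanishes over [b]. If
    [w] never takes the value [eta] there, [w - eta] is a unit, so the cofactor, which up to a power
    of [w] is the geometric sum in [eta / w], is divisible by [u - b]. Integrality works because [n]
    is both the degree of the polar divisor of [u] and the number of eigenvalues of [s]. The
    products [u^j v^i] in [L(M u^*(infinity))] are [nM] in number up to a constant independent of
    [M], and the dimension is at most [nM + 1], so enough powers of the given function must satisfy
    a relation. The gcd hypothesis acts in (ii) => (i): it keeps [v^m] out of [k(u)] for every [m]
    that [n] does not divide. *)

Lemma meval_dhomog (R : comNzRingType) (m d : nat) (G : {mpoly R[m]}) (c : R)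
    (v : 'I_m -> R) :
  G \is d.-homog -> G.@[fun i => c * v i] = c ^+ d * G.@[v].
Proof.
move=> /dhomogP homG; rewrite !mevalE mulr_sumr !big_seq.
apply: eq_bigr => X /homG <-; rewrite mulrCA; congr (_ * _).
under eq_bigr => i _ do rewrite exprMn.
by rewrite big_split /= mdegE -prodrXr.
Qed.

Lemma dhomog_map_mpoly (F K : fieldType) (iota : {rmorphism F -> K}) (m d : nat)
    (G : {mpoly F[m]}) :
  G \is d.-homog -> map_mpoly iota G \is d.-homog.
Proof.
move=> /dhomogP homG; apply/dhomogP => X.
rewrite mcoeff_msupp mcoeff_map_mpoly fmorph_eq0 -mcoeff_msupp.
exact: homG.
Qed.

Lemma closed_algebraic (k : closedFieldType) (K : fieldType)
    (iota : {rmorphism k -> K}) f :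
  algebraicOver iota f -> exists c, f = iota c.
Proof.
case=> p p0; have [rs ->] := closed_field_poly_normal p.
rewrite map_polyZ rootZ ?fmorph_eq0 ?lead_coef_eq0 // rmorph_prod.
elim: rs => [|z rs IH]; first by rewrite big_nil (negPf (root1 _)).
rewrite big_cons rootM => /orP [|/IH //].
by rewrite /= map_polyXsubC root_XsubC => /eqP ->; exists z.
Qed.

Section LocalRing.

Context (k : closedFieldType) (C : smooth_projective_curve k).

Local Notation kC := (funfield C).
Local Notation N := (ambient_dim C).
Local Notation x := (generic_pt C).
Local Notation iota := (const C).
Local Notation ev := (eval_at iota x).

Lemma evalB G H : ev (G - H) = ev G - ev H.
Proof. by rewrite /eval_at rmorphB mevalB. Qed.
Lemma evalD G H : ev (G + H) = ev G + ev H.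
Proof. by rewrite /eval_at rmorphD mevalD. Qed.
Lemma evalM G H : ev (G * H) = ev G * ev H.
Proof. by rewrite /eval_at rmorphM mevalM. Qed.
Lemma evalC c : ev c%:MP = iota c.
Proof. by rewrite /eval_at map_mpolyC mevalC. Qed.
Lemma evalX i : ev 'X_i = x 0 i.
Proof. by rewrite /eval_at map_mpolyX mevalXU. Qed.

Lemma point_on_curve (P : point C) F d :
  F \is d.-homog -> ev F = 0 -> F.@[coords P 0] = 0.
Proof.
move=> homF F0; case: P => p /= pP; rewrite /coords /=.
by case/andP: pP => _ /asboolP onp; apply: onp; split; first by exists d.
Qed.

Lemma eval_neq0 (P : point C) F d :
  F \is d.-homog -> F.@[coords P 0] != 0 -> ev F != 0.
Proof. by move=> homF; apply: contra_neq => /(point_on_curve P homF) ->. Qed.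

Implicit Types (P : point C) (f h : kC) (a b : k).

(** Cross-multiplying two representations of [f] gives a form that vanishes at the generic point,
    hence at [P]. *)
Lemma has_value_inj P f a b : has_value P f a -> has_value P f b -> a = b.
Proof.
move=> [d [G [H [hG hH H0 -> ->]]]] [d' [G' [H' [hG' hH' H0' e ->]]]].
have e0 := eval_neq0 hH H0; have e0' := eval_neq0 hH' H0'.
have e1: ev (G * H' - G' * H) = 0.
  by apply/eqP; rewrite evalB !evalM subr_eq0 -(eqr_div _ _ e0 e0') e.
have hom : G * H' - G' * H \is (d + d').-homog.
  by apply: rpredB; [apply: dhomogM | rewrite addnC; apply: dhomogM].
apply/eqP; rewrite (eqr_div _ _ H0 H0') -subr_eq0 -!mevalM -mevalB.
by apply/eqP/(point_on_curve P hom).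
Qed.

Lemma has_value_const P c : has_value P (iota c) c.
Proof.
have homC b : b%:MP_[N.+1] \is 0.-homog.
  by rewrite -[b%:MP]mulr1 mul_mpolyC; apply: rpredZ; apply: dhomog1.
exists 0%N, c%:MP, 1%:MP; split=> //; last by rewrite !mevalC divr1.
  by rewrite mevalC oner_eq0.
by rewrite !evalC rmorph1 divr1.
Qed.

Lemma has_value1 P : has_value P 1 1.
Proof. by rewrite -{1}(rmorph1 iota); apply: has_value_const. Qed.

Lemma has_value0 P : has_value P 0 0.
Proof. by rewrite -{1}(rmorph0 iota); apply: has_value_const. Qed.

Lemma has_valueD P f h a b :
  has_value P f a -> has_value P h b -> has_value P (f + h) (a + b).
Proof.
move=> [d [G [H [hG hH H0 -> ->]]]] [d' [G' [H' [hG' hH' H0' -> ->]]]].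
have e0 := eval_neq0 hH H0; have e0' := eval_neq0 hH' H0'.
exists (d + d')%N, (G * H' + G' * H), (H * H'); split.
- by apply: rpredD; [apply: dhomogM | rewrite addnC; apply: dhomogM].
- exact: dhomogM.
- by rewrite mevalM mulf_neq0.
- by rewrite evalD !evalM addf_div.
- by rewrite mevalD !mevalM addf_div.
Qed.

Lemma has_valueM P f h a b :
  has_value P f a -> has_value P h b -> has_value P (f * h) (a * b).
Proof.
move=> [d [G [H [hG hH H0 -> ->]]]] [d' [G' [H' [hG' hH' H0' -> ->]]]].
exists (d + d')%N, (G * G'), (H * H'); split.
- exact: dhomogM.
- exact: dhomogM.
- by rewrite mevalM mulf_neq0.
- by rewrite !evalM mulf_div.
- by rewrite !mevalM mulf_div.
Qed.

Lemma has_valueV P f a : a != 0 -> has_value P f a -> has_value P f^-1 a^-1.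
Proof.
move=> a0 [d [G [H [hG hH H0 -> aE]]]].
exists d, H, G; split; rewrite ?invf_div //; last by rewrite aE invf_div.
by apply: contraNneq a0; rewrite aE => ->; rewrite mul0r.
Qed.

Lemma has_valueN P f a : has_value P f a -> has_value P (- f) (- a).
Proof.
move=> vf; rewrite -mulN1r -[- a]mulN1r; apply: has_valueM => //.
by rewrite -(rmorph1 iota) -rmorphN; apply: has_value_const.
Qed.

Lemma has_valueB P f h a b :
  has_value P f a -> has_value P h b -> has_value P (f - h) (a - b).
Proof. by move=> vf vh; apply/has_valueD/has_valueN. Qed.

Lemma has_value_sum P (I : Type) (s : seq I) (Q : pred I)
    (f : I -> kC) (a : I -> k) :
  (forall i, Q i -> has_value P (f i) (a i)) ->
  has_value P (\sum_(i <- s | Q i) f i) (\sum_(i <- s | Q i) a i).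
Proof.
move=> vf; apply: (big_rec2 (has_value P)); first exact: has_value0.
by move=> i b h Qi; apply: has_valueD; apply: vf.
Qed.

Lemma has_value_sum0 P (I : Type) (s : seq I) (Q : pred I) (f : I -> kC) :
  (forall i, Q i -> has_value P (f i) 0) ->
  has_value P (\sum_(i <- s | Q i) f i) 0.
Proof.
move=> vf; apply: (big_ind (fun h => has_value P h 0)) => //.
  exact: has_value0.
by move=> h h' vh vh'; rewrite -(addr0 0); apply: has_valueD.
Qed.

Lemma has_value_prod P (I : Type) (s : seq I) (Q : pred I)
    (f : I -> kC) (a : I -> k) :
  (forall i, Q i -> has_value P (f i) (a i)) ->
  has_value P (\prod_(i <- s | Q i) f i) (\prod_(i <- s | Q i) a i).
Proof.
move=> vf; apply: (big_rec2 (has_value P)); first exact: has_value1.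
by move=> i b h Qi; apply: has_valueM; apply: vf.
Qed.

Lemma has_value_exp P f a m : has_value P f a -> has_value P (f ^+ m) (a ^+ m).
Proof.
move=> vf; elim: m => [|m IH]; first exact: has_value1.
by rewrite !exprS; apply: has_valueM.
Qed.

Lemma has_value_det P m (A : 'M[kC]_m) (B : 'M[k]_m) :
  (forall i j, has_value P (A i j) (B i j)) -> has_value P (\det A) (\det B).
Proof.
move=> vA; apply: has_value_sum => s _; apply: has_valueM.
  rewrite -(rmorph_sign iota); exact: has_value_const.
by apply: has_value_prod => i _.
Qed.

(** Cofactors are polynomials in the entries. With a unit determinant this is Cramer's rule over the
    local ring at [P]. *)
Lemma regular_adj P m (A : 'M[kC]_m) :
  (forall i j, regular_at P (A i j)) -> forall i j, regular_at P ((\adj A) i j).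
Proof.
move=> rA i j; pose B := \matrix_(i, j) projT1 (cid (rA i j)).
have vA i' j' : has_value P (A i' j') (B i' j') by rewrite mxE; case: cid.
exists ((\adj B) i j); rewrite 2![(\adj _) _ _]mxE /cofactor; apply: has_valueM.
  rewrite -(rmorph_sign iota); exact: has_value_const.
by apply: has_value_det => i' j'; rewrite ![row' _ _ _ _]mxE ![col' _ _ _ _]mxE.
Qed.

Lemma regular_const P c : regular_at P (iota c).
Proof. by exists c; apply: has_value_const. Qed.

Lemma regularD P f h : regular_at P f -> regular_at P h -> regular_at P (f + h).
Proof. by move=> [a vf] [b vh]; exists (a + b); apply: has_valueD. Qed.

Lemma regularB P f h : regular_at P f -> regular_at P h -> regular_at P (f - h).
Proof. by move=> [a vf] [b vh]; exists (a - b); apply: has_valueB. Qed.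

Lemma regularM P f h : regular_at P f -> regular_at P h -> regular_at P (f * h).
Proof. by move=> [a vf] [b vh]; exists (a * b); apply: has_valueM. Qed.

Lemma regularX P f m : regular_at P f -> regular_at P (f ^+ m).
Proof. by move=> [a vf]; exists (a ^+ m); apply: has_value_exp. Qed.

Lemma regular_sum P (I : Type) (s : seq I) (Q : pred I)
    (f : I -> kC) :
  (forall i, Q i -> regular_at P (f i)) ->
  regular_at P (\sum_(i <- s | Q i) f i).
Proof.
move=> rf; apply: (big_ind (regular_at P)) => //; last exact: regularD.
by exists 0; apply: has_value0.
Qed.

Lemma has_value_horner P f a (p : {poly k}) :
  has_value P f a -> has_value P (map_poly iota p).[f] p.[a].
Proof.
move=> vf; rewrite horner_coef horner_coef size_map_poly.
apply: has_value_sum => i _; rewrite coef_map.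
by apply: has_valueM; [apply: has_value_const | apply: has_value_exp].
Qed.

Lemma vanish_mul P f h a :
  has_value P f 0 -> has_value P h a -> has_value P (f * h) 0.
Proof. by move=> vf vh; rewrite -(mul0r a); apply: has_valueM. Qed.

(** First-order Taylor expansion at [a], with all higher terms absorbed into coefficients [e j] of
    the maximal ideal. The polynomials with such an expansion contain the constants and variables
    and are closed under sums and products. *)
Lemma taylor1 P (m : nat) (y : 'I_m -> kC) (a : 'I_m -> k)
    (vy : forall j, has_value P (y j) 0) (G : {mpoly k[m]}) :
  exists e : 'I_m -> kC, (forall j, has_value P (e j) 0) /\
    (map_mpoly iota G).@[fun j => iota (a j) + y j] =
      iota G.@[a] + \sum_j (iota (mderiv j G).@[a] + e j) * y j.
Proof.
pose z j := iota (a j) + y j.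
pose T G := exists e : 'I_m -> kC, (forall j, has_value P (e j) 0) /\
    (map_mpoly iota G).@[z] =
      iota G.@[a] + \sum_j (iota (mderiv j G).@[a] + e j) * y j.
rewrite -/z -/(T G).
have TC c : T c%:MP.
  exists (fun=> 0); split=> [j|]; first exact: has_value0.
  rewrite map_mpolyC !mevalC big1 ?addr0 // => j _.
  by rewrite mderivC meval0 rmorph0 addr0 mul0r.
have TX i : T 'X_i.
  exists (fun=> 0); split=> [j|]; first exact: has_value0.
  rewrite map_mpolyX !mevalXU /z; congr (_ + _).
  rewrite (bigD1 i) //= big1 => [|j ji].
    rewrite mderivX mnm1E eqxx scale1r addr0 addr0.
    have -> : (U_(i) - U_(i))%MM = 0%MM :> 'X_{1..m}.
      by apply/mnmP=> j; rewrite mnmBE subnn mnm0E.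
    by rewrite mpolyX0 meval1 rmorph1 mul1r.
  by rewrite mderivX mnm1E eq_sym (negPf ji) scale0r meval0 rmorph0 addr0 mul0r.
have TD F1 F2 : T F1 -> T F2 -> T (F1 + F2).
  move=> [e1 [v1 E1]] [e2 [v2 E2]]; exists (fun j => e1 j + e2 j); split.
    by move=> j; rewrite -(addr0 0); apply: has_valueD.
  rewrite rmorphD !mevalD E1 E2 rmorphD addrACA; congr (_ + _).
  rewrite -big_split; apply: eq_bigr => j _.
  by rewrite mderivD mevalD rmorphD /=; ring.
have TM F1 F2 : T F1 -> T F2 -> T (F1 * F2).
  move=> [e1 [v1 E1]] [e2 [v2 E2]].
  set s2 := \sum_j _ in E2.
  have vs2 : has_value P s2 0.
    apply: has_value_sum0 => j _; rewrite mulrC; apply: vanish_mul (vy j) _.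
    by apply: has_valueD (has_value_const P _) (v2 j).
  exists (fun j => iota (mderiv j F1).@[a] * s2 + e1 j * (iota F2.@[a] + s2)
              + iota F1.@[a] * e2 j); split=> [j|].
    rewrite -(addr0 0) -{1}(addr0 0).
    apply: has_valueD; first apply: has_valueD.
    - by rewrite mulrC; apply: vanish_mul vs2 (has_value_const P _).
    - exact: vanish_mul (v1 j) (has_valueD (has_value_const P _) vs2).
    - by rewrite mulrC; apply: vanish_mul (v2 j) (has_value_const P _).
  rewrite rmorphM !mevalM E1 E2 mulrDl.
  rewrite mulrDr {1}/s2 rmorphM -addrA; congr (_ + _).
  rewrite mulr_suml mulr_sumr -big_split; apply: eq_bigr => j _ /=.
  by rewrite mderivM mevalD !mevalM rmorphD !rmorphM; ring.
elim/mpolyind: G => [|c X G _ _ TG]; first by rewrite -mpolyC0; apply: TC.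
apply: TD TG; rewrite -mul_mpolyC; apply: (TM) => //.
rewrite mpolyXE_id; apply: (big_ind T) => [||i _].
- by rewrite -mpolyC1; apply: TC.
- exact: TM.
elim: (X i) => [|t IH]; first by rewrite expr0 -mpolyC1.
by rewrite exprS; apply: (TM).
Qed.

End LocalRing.

(** * Uniformizers from the Jacobian criterion *)

Lemma euler_formula (R : comNzRingType) (m d : nat) (G : {mpoly R[m]}) :
  G \is d.-homog -> \sum_j 'X_j * mderiv j G = d%:R *: G.
Proof.
move=> /dhomogP homG; rewrite {2}(mpolyE G) scaler_sumr.
under eq_bigr => j _ do rewrite {1}(mpolyE G) raddf_sum mulr_sumr.
rewrite exchange_big /= !big_seq; apply: eq_bigr => X /homG dX.
have {dX} <- : mdeg X = d by [].
rewrite mdegE natr_sum scaler_suml; apply: eq_bigr => j _.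
rewrite mderivZ mderivX scalerA -scalerAr; case: (posnP (X j)) => [->|Xj].
  by rewrite mulr0 !scale0r.
rewrite -mpolyXD addmC submK ?scalerA 1?mulrC //.
by apply/mnm_lepP => i; rewrite mnm1E; case: eqP => // <-.
Qed.

Lemma mxrank_le1 (F : fieldType) (m n : nat) (M : 'M[F]_(m, n)) :
  (\rank M <= 1)%N -> exists (c : 'cV_m) (r : 'rV_n), M = c *m r.
Proof.
rewrite -{2}(mulmx_base M); move: (col_base M) (row_base M).
case: (\rank M) => [|[|//]] A B _; last by exists A, B.
by exists 0, 0; rewrite mul0mx; apply/matrixP=> i j; rewrite !mxE big_ord0.
Qed.

(** The rows of [J] vanish on [p] while the coordinate row of [i0] takes the value 1 there, so that
    row lies outside the row space of [J]. Together they leave a complement of rank at most one,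
    which contributes [c *m r]. *)
Lemma split_identity (F : fieldType) (N : nat) (J : 'M[F]_(N - 1, N.+1))
    (p : 'cV[F]_N.+1) (i0 : 'I_N.+1) :
  \rank J = (N - 1)%N -> J *m p = 0 -> p i0 0 = 1 ->
  exists A (b c : 'cV_N.+1) (r : 'rV_N.+1),
    1%:M = A *m J + b *m delta_mx 0 i0 + c *m r.
Proof.
move=> rJ Jp pi0; set D : 'rV[F]_N.+1 := delta_mx 0 i0.
have nDJ : ~~ (D <= J)%MS.
  apply/negP => /submxP [E DE]; have: (D *m p) 0 0 = 1.
    by rewrite -rowE mxE.
  by rewrite DE -mulmxA Jp mulmx0 mxE => /eqP; rewrite eq_sym oner_eq0.
have rC : (\rank ((J + D)^C)%MS <= 1)%N.
  rewrite mxrank_compl; have: (\rank J < \rank (J + D)%MS)%N.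
    apply: rank_ltmx; rewrite ltmxE addsmxSl.
    by apply: contra nDJ; apply: submx_trans (addsmxSr _ _).
  by rewrite rJ; move: (\rank _) => m; lia.
have := submx_full (1%:M : 'M_N.+1) (addsmx_compl_full (J + D)%MS).
case/sub_addsmxP=> [[E1 E2] /= E].
have /sub_addsmxP [[A b] /= E1E] := submxMl E1 (J + D)%MS.
have [c [r E2E]] : exists (c : 'cV_N.+1) (r : 'rV_N.+1), E2 *m ((J + D)^C)%MS = c *m r.
  by apply: mxrank_le1; apply: leq_trans rC; apply: mxrankM_maxr.
by exists A, b, c, r; rewrite E E1E E2E.
Qed.

Section Uniformizer.

Context (k : closedFieldType) (C : smooth_projective_curve k).

Local Notation kC := (funfield C).
Local Notation N := (ambient_dim C).
Local Notation x := (generic_pt C).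
Local Notation iota := (const C).
Local Notation ev := (eval_at iota x).

Context (P : point C).

Local Notation p := (coords P).

Lemma chart_index : exists i0, p 0 i0 = 1.
Proof.
case: P => q /= /andP [/existsP [i /andP [/eqP qi _]] _].
by exists i.
Qed.

Lemma generic_pt_chart i0 : p 0 i0 = 1 -> x 0 i0 != 0.
Proof.
move=> pi; rewrite -evalX; apply: (@eval_neq0 _ _ P _ 1%N).
  by rewrite dhomogX; apply/eqP/mdeg1.
by rewrite mevalXU pi oner_eq0.
Qed.

Lemma has_value_affine i0 j : p 0 i0 = 1 -> has_value P (x 0 j / x 0 i0) (p 0 j).
Proof.
move=> pi; exists 1%N, 'X_j, 'X_i0; rewrite !evalX !mevalXU pi divr1 oner_eq0.
by split=> //; rewrite dhomogX; apply/eqP/mdeg1.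
Qed.

Lemma eval_dehomogenize i0 d G : p 0 i0 = 1 -> G \is d.-homog ->
  ev G = x 0 i0 ^+ d * (map_mpoly iota G).@[fun j => x 0 j / x 0 i0].
Proof.
move=> pi hG; rewrite -meval_dhomog ?dhomog_map_mpoly //; apply: meval_eq => j.
by rewrite mulrC divfK ?generic_pt_chart.
Qed.

(* With [y = x / x_i0 - p], expanding the equations at [p] gives [J y = - e y]
   with [e] in the maximal ideal, and Euler's formula gives [J p = 0]; hence
   [(1 + A e) y = t c] for a single [t], with [1 + A e] invertible. *)
Lemma max_ideal_principal i0 : p 0 i0 = 1 -> exists t,
  [/\ has_value P t 0,
   forall f, has_value P f 0 -> exists2 h, regular_at P h & f = t * h &
   forall j, exists2 h, regular_at P h & x 0 j / x 0 i0 - iota (p 0 j) = t * h].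
Proof.
move=> pi; pose z j := x 0 j / x 0 i0; pose y j := z j - iota (p 0 j).
have vy j : has_value P (y j) 0.
  by rewrite -(subrr (p 0 j)); apply/has_valueB/has_value_const/has_value_affine.
have zE G : (map_mpoly iota G).@[z] = (map_mpoly iota G).@[fun j => iota (p 0 j) + y j].
  by apply: meval_eq => j; rewrite addrC subrK.
have nP : normalized p by case: (P) => q /= /andP [].
have onP : on_variety iota x p by case: (P) => q /= /andP [_ /asboolP].
have [F [vF rJ]] := curve_smooth nP onP.
set J := \matrix_(i, j) _ in rJ.
have Jp : J *m p^T = 0.
  apply/matrixP => i j; rewrite !mxE; case: (vF i) => [[d hF] F0].
  have := congr1 (meval (p 0)) (euler_formula hF).
  rewrite mevalZ (point_on_curve P hF F0) mulr0 raddf_sum /= => E0.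
  rewrite -[RHS]E0.
  by apply: eq_bigr => l _; rewrite mevalM mevalXU !mxE ord1 mulrC.
have pTi : p^T i0 0 = 1 by rewrite mxE.
have [A [b [c [r E]]]] := split_identity rJ Jp pTi.
have ex i : exists e : 'I_N.+1 -> kC, (forall j, has_value P (e j) 0) /\
    \sum_j (iota (J i j) + e j) * y j = 0.
  have [e [ve]] := taylor1 (p 0) vy (F i); case: (vF i) => [[d hF] F0].
  rewrite (point_on_curve P hF F0) rmorph0 add0r -zE => e0.
  exists e; split=> //; under eq_bigr => j _ do rewrite mxE.
  rewrite -e0; move: F0; rewrite (eval_dehomogenize pi hF) => /eqP.
  by rewrite mulf_eq0 expf_eq0 (negPf (generic_pt_chart pi)) andbF => /eqP.
pose e := \matrix_(i, j) projT1 (cid (ex i)) j.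
pose Y : 'cV[kC]_N.+1 := \col_j y j.
have ve i j : has_value P (e i j) 0 by rewrite mxE; case: cid => ? [].
have JY : map_mx iota J *m Y = - (e *m Y).
  apply/eqP; rewrite -addr_eq0 -mulmxDl; apply/eqP/matrixP => i j.
  rewrite !mxE; case: (projT2 (cid (ex i))) => _ E0.
  rewrite -[RHS]E0.
  by apply: eq_bigr => l _; rewrite !mxE.
pose t := (map_mx iota r *m Y) 0 0.
have vt : has_value P t 0.
  rewrite /t mxE.
  apply: has_value_sum0 => j _; rewrite !mxE mulrC.
  by apply: vanish_mul (vy j) (has_value_const _ _).
have rt : map_mx iota r *m Y = t%:M by rewrite [LHS]mx11_scalar.
have yi0 : y i0 = 0 by rewrite /y /z divff ?generic_pt_chart // pi rmorph1 subrr.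
pose M := 1%:M + map_mx iota A *m e.
have MY : M *m Y = t *: map_mx iota c.
  have := congr1 (fun B => map_mx iota B *m Y) E => /=.
  rewrite map_scalar_mx rmorph1 mul1mx !map_mxD !map_mxM !mulmxDl.
  rewrite -!mulmxA JY rt mul_mx_scalar map_delta_mx -rowE.
  have -> : row i0 Y = 0 by apply/rowP => j; rewrite !mxE yi0.
  rewrite mulmx0 addr0 mulmxN => YE.
  by rewrite mul1mx {1}YE addrAC addNr add0r.
(* At [P] the matrix [M] becomes the identity, so its determinant is a unit and [MY] can be solved
   for [Y]. *)
have vM i j : has_value P (M i j) ((1%:M : 'M[k]_N.+1) i j).
  rewrite !mxE -[X in has_value _ _ X]addr0; apply: has_valueD.
    by rewrite -(rmorph_nat iota); apply: has_value_const.
  apply: has_value_sum0 => l _; rewrite mulrC.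
  by apply: vanish_mul; rewrite // ?mxE; apply: has_value_const.
have vdM := has_value_det vM; rewrite det1 in vdM.
have rdM : regular_at P (\det M)^-1.
  by exists 1^-1; apply: has_valueV; rewrite ?oner_eq0.
have dM0 : \det M != 0.
  apply/eqP => d0; move: vdM; rewrite d0 => /(has_value_inj (has_value0 P)) /eqP.
  by rewrite eq_sym oner_eq0.
have hy j : exists2 h, regular_at P h & y j = t * h.
  exists ((\det M)^-1 * (\adj M *m map_mx iota c) j 0).
    apply: regularM => //; rewrite mxE; apply: regular_sum => l _.
    apply: regularM; last by rewrite mxE; apply: regular_const.
    by apply: regular_adj => i' j'; exists ((1%:M : 'M[k]_N.+1) i' j').
  have := congr1 (fun B => (\adj M *m B) j 0) MY.
  rewrite /= mulmxA mul_adj_mx mul_scalar_mx -scalemxAr [in LHS]mxE [in RHS]mxE.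
  by rewrite [Y _ _]mxE mulrCA => <-; rewrite mulKf.
exists t; split=> // f vf.
have [d [G [H [hG hH H0 fE aE]]]] := vf.
move/eqP: aE; rewrite eq_sym mulf_eq0 invr_eq0 (negPf H0) orbF => /eqP G0.
have [g [vg]] := taylor1 (p 0) vy G; rewrite -zE G0 rmorph0 add0r => GE.
have rH : regular_at P ((map_mpoly iota H).@[z])^-1.
  exists (H.@[p 0])^-1; apply: has_valueV => //.
  rewrite zE; have [g' [vg' ->]] := taylor1 (p 0) vy H.
  rewrite -[X in has_value _ _ X]addr0; apply: has_valueD (has_value_const _ _) _.
  apply: has_value_sum0 => j _; rewrite mulrC; apply: vanish_mul (vy j) _.
  exact: has_valueD (has_value_const _ _) (vg' j).
have fE' : f = (map_mpoly iota G).@[z] / (map_mpoly iota H).@[z].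
  rewrite fE (eval_dehomogenize pi hG) (eval_dehomogenize pi hH) -mulf_div.
  by rewrite divff ?mul1r // expf_eq0 (negPf (generic_pt_chart pi)) andbF.
pose hh j := projT1 (cid2 (hy j)).
exists ((\sum_j (iota (mderiv j G).@[p 0] + g j) * hh j) / (map_mpoly iota H).@[z]).
  apply: regularM => //; apply: regular_sum => j _; apply: regularM.
    by apply: regularD (regular_const _ _) _; exists 0.
  by rewrite /hh; case: cid2.
rewrite mulrA fE' GE; congr (_ / _); rewrite mulr_sumr; apply: eq_bigr => j _.
by rewrite mulrCA; congr (_ * _); rewrite /hh; case: cid2.
Qed.

End Uniformizer.

(** * Algebraic dependence *)

Section AdjoinField.

Context (k K : fieldType) (iota : {rmorphism k -> K}) (S : seq K).

Definition adjoin_pred : {pred K} := fun f => `[< adjoin iota S f >].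

Lemma adjoin_divring : divring_closed adjoin_pred.
Proof.
split.
- by apply/asboolP; rewrite -(rmorph1 iota); apply: adjoin_const.
- by move=> f h /asboolP af /asboolP ah; apply/asboolP/adjoin_sub.
- move=> f h /asboolP af /asboolP ah.
  by apply/asboolP/adjoin_mul => //; apply: adjoin_inv.
Qed.

HB.instance Definition _ :=
  GRing.isDivringClosed.Build K adjoin_pred adjoin_divring.

(** The subfield as a [fieldType] of its own, so that polynomials over it, [algebraicOver] and
    [integralOver] make sense. *)
Record adjoin_field :=
  AdjoinField { adjoin_val : K; _ : adjoin_val \in adjoin_pred }.

HB.instance Definition _ := [isSub for adjoin_val].
HB.instance Definition _ := [Choice of adjoin_field by <:].
HB.instance Definition _ :=
  [SubChoice_isSubIntegralDomain of adjoin_field by <:].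
HB.instance Definition _ :=
  [SubIntegralDomain_isSubField of adjoin_field by <:].

Definition adjoin_emb (c : adjoin_field) : K := val c.

HB.instance Definition _ := GRing.RMorphism.copy adjoin_emb val.

Lemma adjoinP f : adjoin iota S f <-> exists c, f = adjoin_emb c.
Proof.
split=> [af|[[c cP] ->]]; last exact/asboolP.
have fP : f \in adjoin_pred by apply/asboolP.
by exists (AdjoinField fP).
Qed.

Lemma adjoin_embP (c : adjoin_field) : adjoin iota S (adjoin_emb c).
Proof. by apply/adjoinP; exists c. Qed.

End AdjoinField.

Arguments adjoin_emb {k K iota S} c.

Section PolyEval.

Context (k K : fieldType) (iota : {rmorphism k -> K}).

(** Made a ring morphism in [p] just below, so that [integralOver (peval u)] means integral over
    [k[u]]. *)
Definition peval (t : K) (p : {poly k}) : K := (map_poly iota p).[t].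

HB.instance Definition _ (t : K) :=
  GRing.RMorphism.copy (peval t) (horner_eval t \o map_poly iota).

Lemma pevalE t p : peval t p = (map_poly iota p).[t].
Proof. by []. Qed.

Lemma pevalC t c : peval t c%:P = iota c.
Proof. by rewrite /peval map_polyC hornerC. Qed.

Lemma pevalX t : peval t 'X = t.
Proof. by rewrite /peval map_polyX hornerX. Qed.

Lemma pevalXsubC t c : peval t ('X - c%:P) = t - iota c.
Proof. by rewrite rmorphB /= pevalX pevalC. Qed.

Lemma pevalZ t c p : peval t (c *: p) = iota c * peval t p.
Proof. by rewrite -mul_polyC rmorphM /= pevalC. Qed.

Lemma peval_eq0 t p : ~ algebraicOver iota t -> (peval t p == 0) = (p == 0).
Proof.
move=> trt; apply/eqP/eqP => [pt|->]; last exact: rmorph0.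
by apply/eqP; apply: contra_notT trt => p0; exists p; last exact/eqP.
Qed.

Lemma adjoin_peval S t p : adjoin iota S t -> adjoin iota S (peval t p).
Proof.
move=> /adjoinP [c ->]; rewrite /peval horner_coef; apply/adjoinP.
pose F i := (map_poly iota p)`_i.
have /choice [b bE] : forall i, exists b : adjoin_field iota S, F i = adjoin_emb b.
  by move=> i; apply/adjoinP; rewrite /F coef_map; apply: adjoin_const.
exists (\sum_(i < size (map_poly iota p)) b i * c ^+ i).
rewrite rmorph_sum; apply: eq_bigr => i _.
by rewrite rmorphM rmorphXn /= -bE.
Qed.

Lemma adjoin1_frac t f : adjoin iota [:: t] f ->
  exists p q, peval t q != 0 /\ f = peval t p / peval t q.
Proof.
elim=> [c|s|_ _ _ [p [q [q0 ->]]] _ [p' [q' [q0' ->]]]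
  |_ _ _ [p [q [q0 ->]]] _ [p' [q' [q0' ->]]]|_ _ [p [q [q0 ->]]]].
- by exists c%:P, 1; rewrite rmorph1 pevalC divr1 oner_eq0.
- rewrite inE => /eqP ->.
  by exists 'X, 1; rewrite rmorph1 pevalX divr1 oner_eq0.
- exists (p * q' - p' * q), (q * q'); rewrite rmorphB !rmorphM /= mulf_neq0 //.
  by split=> //; field; rewrite q0 q0'.
- exists (p * p'), (q * q'); rewrite !rmorphM /= mulf_neq0 //.
  by rewrite mulf_div.
- have [p0|p0] := eqVneq (peval t p) 0; last by exists q, p; rewrite invf_div.
  by exists 0, 1; rewrite p0 rmorph0 rmorph1 !mul0r invr0 oner_eq0.
Qed.

Lemma clear_denominators t (A : {poly K}) :
  (forall i, adjoin iota [:: t] A`_i) ->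
  exists q R, peval t q != 0 /\ peval t q *: A = map_poly (peval t) R.
Proof.
elim/poly_ind: A => [_|A c IH aA].
  by exists 1, 0; rewrite rmorph1 oner_eq0 scaler0 rmorph0.
have [i|q [R [q0 E]]] := IH.
  by have := aA i.+1; rewrite coefD coefMX coefC addr0.
have := aA 0%N; rewrite coefD coefMX coefC add0r => /adjoin1_frac.
move=> [p' [q' [q0' ->]]].
exists (q * q'), ((q'%:P * R) * 'X + (q * p')%:P).
rewrite rmorphM /= mulf_neq0 //; split=> //.
rewrite rmorphD !rmorphM /= map_polyX !map_polyC /= -!mul_polyC !rmorphM /=.
rewrite -E -mul_polyC mulrDr -!polyCM; congr (_ + _); first by rewrite polyCM; ring.
by apply: congr1; field.
Qed.

(** Dependence as a bivariate relation, which is symmetric in [t] and [f] after swapping the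
    variables. Only for transcendental [t] does [R != 0] guarantee a nonzero polynomial after
    substituting [t]. *)
Definition alg_rel (t f : K) :=
  exists2 R : {poly {poly k}}, R != 0 & (map_poly (peval t) R).[f] = 0.

Lemma root_alg_rel t f (A : {poly K}) : A != 0 ->
  (forall i, adjoin iota [:: t] A`_i) -> root A f -> alg_rel t f.
Proof.
move=> A0 /clear_denominators [q [R [q0 E]]] rA; exists R; last first.
  by rewrite -E hornerZ (rootP rA) mulr0.
by apply: contra_neq A0 => R0; apply/eqP; move/eqP: E; rewrite R0 rmorph0 scaler_eq0 (negPf q0).
Qed.

Lemma alg_relC t f : alg_rel t f -> alg_rel f t.
Proof.
move=> [R R0 Rtf]; exists (swapXY R); rewrite ?swapXY_eq0 //.
have E s g Q : (map_poly (peval s) Q).[g] =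
    (map_poly (map_poly iota) Q).[g, s].
  have -> : map_poly (peval s) Q = map_poly (horner_eval s) (map_poly (map_poly iota) Q).
    by apply/polyP => i; rewrite !coef_map.
  by rewrite -horner_swapXY horner2_swapXY.
by rewrite E -swapXY_map horner2_swapXY -E.
Qed.

Lemma alg_rel_algebraic t f : ~ algebraicOver iota t -> alg_rel t f ->
  algebraicOver (adjoin_emb (iota := iota) (S := [:: t])) f.
Proof.
move=> trt [R R0 Rtf].
have /choice [b bE] : forall p, exists b : adjoin_field iota [:: t],
    peval t p = adjoin_emb b.
  by move=> p; apply/adjoinP/adjoin_peval/adjoin_gen; rewrite inE.
have E : map_poly adjoin_emb (\poly_(i < size R) b R`_i) = map_poly (peval t) R.
  apply/polyP => i; rewrite !coef_map coef_poly; case: ltnP => [_|sz].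
    by rewrite /= -bE.
  by rewrite /= (nth_default 0 sz) !raddf0.
exists (\poly_(i < size R) b R`_i); last by rewrite E; apply/eqP.
rewrite -(map_poly_eq0 adjoin_emb) E; apply: contra_neq R0 => R0.
apply/polyP => i; rewrite coef0; apply/eqP; rewrite -(peval_eq0 _ trt).
by rewrite -[peval _ _]coef_map R0 coef0.
Qed.

(* Exchange: the transcendental [t] can replace the transcendence basis. *)
Lemma trdeg1_alg_rel t f : has_trdeg1 iota -> ~ algebraicOver iota t ->
  alg_rel t f.
Proof.
move=> [t0 trt0 alg0] trt.
have {}alg0 h : alg_rel t0 h.
  by have [A [A0 aA rA]] := alg0 h; apply: root_alg_rel rA.
have int0 := alg_rel_algebraic trt (alg_relC (alg0 t)).
have [R R0 Rf] := alg0 f.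
suff /integral_algebraic [A A0 rA] :
    integralOver (adjoin_emb (iota := iota) (S := [:: t])) f.
  apply: (root_alg_rel (A := map_poly adjoin_emb A)) rA.
    by rewrite map_poly_eq0.
  by move=> i; rewrite coef_map; apply: adjoin_embP.
apply: integral_root (introT eqP Rf) _.
  apply: contra_neq R0 => R0; apply/polyP => i; rewrite coef0; apply/eqP.
  by rewrite -(peval_eq0 _ trt0) -coef_map R0 coef0.
move=> _ /(nthP 0) [i _ <-]; rewrite coef_map /= /peval.
apply: integral_horner; last exact/integral_algebraic.
move=> _ /(nthP 0) [j _ <-]; rewrite coef_map /=.
have /adjoinP [c ->] : adjoin iota [:: t] (iota R`_i`_j) by apply: adjoin_const.
exact: integral_id.
Qed.

End PolyEval.

(** * The order of vanishing *)

Section Valuation.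

Context (k : closedFieldType) (C : smooth_projective_curve k).

Local Notation kC := (funfield C).
Local Notation N := (ambient_dim C).
Local Notation x := (generic_pt C).
Local Notation iota := (const C).
Local Notation peval := (peval iota).

Implicit Types (P : point C) (f h t : kC) (m n : int).

Lemma nonconst_transcendental f : ~ is_const f -> ~ algebraicOver iota f.
Proof. by move=> nf /closed_algebraic. Qed.

Lemma exists_nonconst : exists t, ~ is_const t.
Proof.
have [t trt _] := curve_dim1 C; exists t => -[c tc].
by apply: trt; rewrite tc; apply: algebraic_id.
Qed.

Lemma frac_regular P f :
  exists g h, [/\ regular_at P g, regular_at P h, h != 0 & f = g / h].
Proof.
have [i0 pi] := chart_index P.
elim: (funfield_generated f) => [c|s|_ _ _ [g [h [rg rh h0 ->]]]
    _ [g' [h' [rg' rh' h0' ->]]]|_ _ _ [g [h [rg rh h0 ->]]]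
    _ [g' [h' [rg' rh' h0' ->]]]|_ _ [g [h [rg rh h0 ->]]]].
- exists (iota c), 1; rewrite divr1 oner_eq0; split=> //.
    exact: regular_const.
  by exists 1; apply: has_value1.
- case/imageP => [[i j] _ -> /=].
  have [xj|xj] := eqVneq (x 0 j) 0.
    exists 0, 1; rewrite xj invr0 mulr0 mul0r oner_eq0; split=> //.
      by exists 0; apply: has_value0.
    by exists 1; apply: has_value1.
  exists (x 0 i / x 0 i0), (x 0 j / x 0 i0); split.
  + by exists (coords P 0 i); apply: has_value_affine.
  + by exists (coords P 0 j); apply: has_value_affine.
  + by rewrite mulf_neq0 ?invr_eq0 ?(generic_pt_chart pi).
  + by field; rewrite xj (generic_pt_chart pi).
- exists (g * h' - g' * h), (h * h'); split.
  + by apply: regularB; apply: regularM.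
  + exact: regularM.
  + exact: mulf_neq0.
  + by field; rewrite h0 h0'.
- exists (g * g'), (h * h'); split; try exact: regularM.
  + exact: mulf_neq0.
  + by rewrite mulf_div.
- have [g0|g0] := eqVneq g 0.
    exists 0, 1; rewrite g0 !mul0r invr0 oner_eq0; split=> //.
      by exists 0; apply: has_value0.
    by exists 1; apply: has_value1.
  by exists h, g; rewrite invf_div.
Qed.

Lemma uniformizer_exists P : exists t, uniformizer P t.
Proof.
have [i0 pi] := chart_index P; have [t [vt gent _]] := max_ideal_principal pi.
exists t => f; split=> [/gent //|[h [a vh] ->]].
exact: vanish_mul vh.
Qed.

Lemma uniformizer_value P t : uniformizer P t -> has_value P t 0.
Proof.
move=> ut; apply/ut; exists 1; last by rewrite mulr1.
by exists 1; apply: has_value1.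
Qed.

(** If [t] were 0, the maximal ideal would vanish, the affine coordinates around [P] would be
    constants, and so would every function they generate. *)
Lemma uniformizer_neq0 P t : uniformizer P t -> t != 0.
Proof.
move=> ut; apply/eqP => t0.
have max0 f : has_value P f 0 -> f = 0 by move=> /ut [h _ ->]; rewrite t0 mul0r.
have [i0 pi] := chart_index P; have [t' [/max0 -> _ xE]] := max_ideal_principal pi.
have {}xE j : x 0 j / x 0 i0 = iota (coords P 0 j).
  by apply/eqP; rewrite -subr_eq0; have [h _ ->] := xE j; rewrite mul0r.
have [f []] := exists_nonconst.
elim: (funfield_generated f) => [c|s|_ _ _ [c ->] _ [c' ->]
    |_ _ _ [c ->] _ [c' ->]|_ _ [c ->]].
- by exists c.
- case/imageP => [[i j] _ -> /=]; exists (coords P 0 i / coords P 0 j).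
  rewrite fmorph_div -!xE invf_div mulrA divfK //.
  exact: generic_pt_chart pi.
- by exists (c - c'); rewrite rmorphB.
- by exists (c * c'); rewrite rmorphM.
- by exists c^-1; rewrite fmorphV.
Qed.

Lemma uniformizer_transcendental P t : uniformizer P t -> ~ algebraicOver iota t.
Proof.
move=> ut; apply: nonconst_transcendental => -[c tc].
have := uniformizer_value ut; rewrite tc => /(has_value_inj (has_value_const P c)) c0.
by have := uniformizer_neq0 ut; rewrite tc c0 rmorph0 eqxx.
Qed.

Lemma value1_neq0 P f : has_value P f 0 -> f != 1.
Proof.
move=> v0; apply/eqP => f1; move: v0; rewrite f1.
by move/(has_value_inj (has_value1 P))/eqP; rewrite oner_eq0.
Qed.

Lemma local_unit_neq0 P h : local_unit P h -> h != 0.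
Proof.
case=> a a0 vh; apply: contraNneq a0 => h0; move: vh; rewrite h0.
by move/(has_value_inj (has_value0 P)) <-.
Qed.

Lemma local_unitV P h : local_unit P h -> local_unit P h^-1.
Proof. by case=> a a0 vh; exists a^-1; rewrite ?invr_eq0 //; apply: has_valueV. Qed.

Lemma local_unitM P f h : local_unit P f -> local_unit P h -> local_unit P (f * h).
Proof.
by case=> a a0 vf [b b0 vh]; exists (a * b); [apply: mulf_neq0 | apply: has_valueM].
Qed.

Lemma local_unit_regular P h : local_unit P h -> regular_at P h.
Proof. by case=> a _ vh; exists a. Qed.

Lemma local_unit1 P : local_unit P 1.
Proof. by exists 1; [apply: oner_neq0 | apply: has_value1]. Qed.

(* A relation [c(t) + g w = 0] with [c != 0] bounds the powers of [t]
   dividing [g], since [c(t)] is a unit times a power of [t]. *)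
Lemma order_regular P t g : uniformizer P t -> regular_at P g -> g != 0 ->
  exists (m : nat) h, local_unit P h /\ g = t ^+ m * h.
Proof.
move=> ut rg g0; have trt := uniformizer_transcendental ut.
have t0 := uniformizer_neq0 ut.
have [c [w [c0 rw cw]]] :
    exists (c : {poly k}) w, [/\ c != 0, regular_at P w & peval t c = g * w].
  have [R] := trdeg1_alg_rel g (curve_dim1 C) trt.
  elim/poly_ind: R => [|A c IH R0]; first by rewrite eqxx.
  rewrite rmorphD rmorphM /= map_polyX map_polyC !hornerE.
  rewrite -[X in _ + X = 0]/(peval t c).
  (* A relation without constant term can be divided by [g], which is nonzero; the induction
     continues with the quotient. *)
  have [c0|c0] := eqVneq c 0.
    rewrite c0 rmorph0 addr0 => /eqP; rewrite mulf_eq0 (negPf g0) orbF => /eqP.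
    apply: IH; apply: contra_neq R0 => ->; by rewrite c0 mul0r addr0.
  move=> /eqP; rewrite addrC addr_eq0 => /eqP E.
  exists c, (- (map_poly (peval t) A).[g]); split=> //; last by rewrite mulrN mulrC.
  rewrite -sub0r; apply: regularB; first by exists 0; apply: has_value0.
  rewrite horner_coef; apply: regular_sum => i _; apply: regularM.
    rewrite coef_map; exists (A`_i).[0]; apply: has_value_horner.
    exact: uniformizer_value.
  exact: regularX.
have [s [q /implyP q0 cE]] := multiplicity_XsubC c 0.
have {}q0 := q0 c0; rewrite subr0 in cE.
have vq := has_value_horner q (uniformizer_value ut).
have bound (m : nat) : (exists2 h, regular_at P h & g = t ^+ m * h) -> (m <= s)%N.
  move=> [h rh gE]; rewrite leqNgt; apply/negP => sm.
  case/negP: q0; rewrite /root; apply/eqP.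
  apply: has_value_inj vq _; apply/ut; exists (t ^+ (m - s.+1) * h * w).
    by do 2!apply: regularM => //; apply: regularX; exists 0; apply: uniformizer_value.
  apply: (mulIf (expf_neq0 s t0)); move: cw; rewrite cE gE rmorphM rmorphXn /=.
  rewrite pevalX pevalE => ->; rewrite -(subnK sm) exprD exprS addnK; ring.
pose Q (m : nat) := `[< exists2 h, regular_at P h & g = t ^+ m * h >].
have exQ : exists m : nat, Q m.
  by exists 0%N; apply/asboolP; exists g => //; rewrite expr0 mul1r.
have ubQ (m : nat) : Q m -> (m <= s)%N by move/asboolP/bound.
case: (ex_maxnP exQ ubQ) => m /asboolP [h rh gE] maxm.
exists m, h; split=> //; case: rh => b vh; exists b => //.
apply/eqP => b0; rewrite b0 in vh; have [h' rh' hE] := (ut h).1 vh.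
suff /maxm : Q m.+1 by rewrite ltnn.
by apply/asboolP; exists h' => //; rewrite gE hE exprSr mulrA.
Qed.

Lemma order_exists P t f : uniformizer P t -> f != 0 ->
  exists m h, local_unit P h /\ f = t ^ m * h.
Proof.
move=> ut f0; have [g [g' [rg rg' g0' fE]]] := frac_regular P f.
have g0 : g != 0 by apply: contraNneq f0 => g0; rewrite fE g0 mul0r.
have t0 := uniformizer_neq0 ut.
have [m [h [uh gE]]] := order_regular ut rg g0.
have [m' [h' [uh' gE']]] := order_regular ut rg' g0'.
exists (m%:Z - m'%:Z), (h / h'); split.
  by apply: local_unitM => //; apply: local_unitV.
rewrite fE gE gE' expfzDr // -exprnN -exprnP; field.
by rewrite (local_unit_neq0 uh') expf_neq0.
Qed.

(** Uniqueness of the order: with a positive exponent, 1 would lie in the maximal ideal; a negative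
    one is reduced to this by inverting. *)
Lemma exprz_unit_eq1 P t m h : uniformizer P t -> local_unit P h ->
  t ^ m * h = 1 -> m = 0.
Proof.
move=> ut; have t0 := uniformizer_neq0 ut.
have aux (j : nat) h' : local_unit P h' -> t ^+ j * h' = 1 -> j = 0%N.
  case: j => // j uh; rewrite exprS -mulrA => e1.
  have : has_value P 1 0.
    apply/ut; exists (t ^+ j * h'); last by rewrite e1.
    apply: regularM; last exact: local_unit_regular.
    by apply: regularX; exists 0; apply: uniformizer_value.
  by move/value1_neq0; rewrite eqxx.
move=> uh; case: (intP m) => // j.
  by rewrite -exprnP => /(aux _ _ uh).
rewrite -exprnN => /(congr1 GRing.inv); rewrite invr1 invfM invrK => e1.
by have := aux _ _ (local_unitV uh) e1.
Qed.

Lemma uniformizer_assoc P t t' : uniformizer P t -> uniformizer P t' ->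
  exists2 h, local_unit P h & t' = t * h.
Proof.
move=> ut ut'; have t0' := uniformizer_neq0 ut'.
have [h [a vh] E] := (ut t').1 (uniformizer_value ut').
have [h' [b vh'] E'] := (ut' t).1 (uniformizer_value ut).
exists h => //; exists a => //; apply/eqP => a0.
have e1 : h * h' = 1 by apply: (mulfI t0'); rewrite mulr1 {2}E E'; ring.
have : has_value P (h * h') 0 by apply: vanish_mul vh'; rewrite -a0.
by move/value1_neq0; rewrite e1 eqxx.
Qed.

Lemma local_unitXz P h m : local_unit P h -> local_unit P (h ^ m).
Proof.
have aux h' (j : nat) : local_unit P h' -> local_unit P (h' ^+ j).
  by case=> a a0 vh; exists (a ^+ j); [rewrite expf_neq0 | apply: has_value_exp].
move=> uh; case: m => j; first exact: aux.
by rewrite NegzE -exprnN; apply/local_unitV/aux.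
Qed.

Lemma ord_eq P t m h : uniformizer P t -> local_unit P h -> ord P (t ^ m * h) = m.
Proof.
move=> ut uh; rewrite /ord; case: pselect => [ex|[]]; last first.
  by exists m, t, h.
case: (cid ex) => m' [t' [h' [ut' uh' E]]] /=.
have [v uv tE] := uniformizer_assoc ut ut'.
have t0 := uniformizer_neq0 ut; have v0 := local_unit_neq0 uv.
have h0 := local_unit_neq0 uh.
apply/eqP; rewrite eq_sym -subr_eq0; apply/eqP.
apply: (@exprz_unit_eq1 P t _ (h / (v ^ m' * h'))) => //.
  by apply: local_unitM => //; apply/local_unitV/local_unitM => //; apply: local_unitXz.
rewrite expfzDr // -invr_expz mulf_div E tE expfzMl mulrA divff //.
by rewrite !mulf_neq0 ?expfz_neq0 ?(local_unit_neq0 uh').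
Qed.

Lemma ordP P t f : uniformizer P t -> f != 0 ->
  exists2 h, local_unit P h & f = t ^ (ord P f) * h.
Proof.
move=> ut f0; have [m [h [uh E]]] := order_exists ut f0.
by exists h => //; rewrite {2}E ord_eq.
Qed.

Lemma ord_zero P : ord P 0 = 0.
Proof.
rewrite /ord; case: pselect => // ex; exfalso.
case: ex => m [t [h [ut uh /esym/eqP]]].
by rewrite mulf_eq0 (negPf (local_unit_neq0 uh)) expfz_eq0 (negPf (uniformizer_neq0 ut)) andbF.
Qed.

Lemma ordM P f h : f != 0 -> h != 0 -> ord P (f * h) = ord P f + ord P h.
Proof.
move=> f0 h0; have [t ut] := uniformizer_exists P.
have [f' uf E] := ordP ut f0; have [h' uh E'] := ordP ut h0.
rewrite {1}E {1}E' mulrACA -expfzDr ?(uniformizer_neq0 ut) //.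
by apply: ord_eq => //; apply: local_unitM.
Qed.

Lemma ord_unit P h : local_unit P h -> ord P h = 0.
Proof.
move=> uh; have [t ut] := uniformizer_exists P.
by rewrite -[h]mul1r -(expr0z t) ord_eq.
Qed.

Lemma ord_one P : ord P 1 = 0.
Proof. exact/ord_unit/local_unit1. Qed.

Lemma ordV P f : ord P f^-1 = - ord P f.
Proof.
have [->|f0] := eqVneq f 0; first by rewrite invr0 ord_zero oppr0.
apply/eqP; rewrite -addr_eq0 -ordM ?invr_eq0 // mulVf //.
by rewrite ord_one.
Qed.

Lemma ordX P f (j : nat) : ord P (f ^+ j) = ord P f *+ j.
Proof.
have [->|f0] := eqVneq f 0.
  by rewrite expr0n; case: eqP => [->|_]; rewrite ?ord_one ord_zero ?mul0rn.
elim: j => [|j IH]; first by rewrite ord_one.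
by rewrite exprS ordM ?expf_neq0 // IH mulrS.
Qed.

Lemma ordXz P f m : ord P (f ^ m) = ord P f * m.
Proof.
case: m => j; first by rewrite -exprnP ordX -mulr_natr natz.
by rewrite NegzE -exprnN ordV ordX -mulr_natr natz mulrN.
Qed.

Lemma ord_prod P (I : Type) (s : seq I) (Q : pred I) (f : I -> kC) :
  (forall i, Q i -> f i != 0) ->
  ord P (\prod_(i <- s | Q i) f i) = \sum_(i <- s | Q i) ord P (f i).
Proof.
move=> f0; elim: s => [|i s IH]; first by rewrite !big_nil ord_one.
rewrite !big_cons; case: ifP => // Qi; rewrite ordM ?f0 // ?IH //.
apply: (big_ind (fun y => y != 0)) => //; first exact: oner_neq0.
by move=> *; apply: mulf_neq0.
Qed.

Lemma regular_ord P f : regular_at P f <-> 0 <= ord P f.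
Proof.
have [->|f0] := eqVneq f 0.
  by rewrite ord_zero; split=> // _; exists 0; apply: has_value0.
have [t ut] := uniformizer_exists P; split=> [rf|].
  have [m [h [uh ->]]] := order_regular ut rf f0.
  by rewrite exprnP ord_eq.
have [h uh E] := ordP ut f0; rewrite {2}E; case: (ord P f) => // m _.
apply: regularM; last exact: local_unit_regular.
by apply: regularX; exists 0; apply: uniformizer_value.
Qed.

Lemma local_unit_ord P f : f != 0 -> local_unit P f <-> ord P f = 0.
Proof.
move=> f0; split; first exact: ord_unit.
have [t ut] := uniformizer_exists P; have [h uh E] := ordP ut f0.
by move=> o0; rewrite E o0 expr0z mul1r.
Qed.

Lemma value0_ord P f : f != 0 -> has_value P f 0 <-> 0 < ord P f.
Proof.
move=> f0; split=> [v0|o0].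
  have /regular_ord : regular_at P f by exists 0.
  rewrite le_eqVlt => /orP [/eqP o0|//].
  have /(local_unit_ord P f0) [a a0 va] : ord P f = 0 by [].
  by rewrite (has_value_inj va v0) eqxx in a0.
have /regular_ord [a va] := ltW o0.
have [a0|a0] := eqVneq a 0; first by rewrite -a0.
have /ord_unit o1 : local_unit P f by exists a.
by rewrite o1 ltxx in o0.
Qed.

Lemma ord_const P c : ord P (iota c) = 0.
Proof.
have [->|c0] := eqVneq c 0; first by rewrite rmorph0 ord_zero.
by apply: ord_unit; exists c => //; apply: has_value_const.
Qed.

(* [f = 0] is allowed, with the value [+oo] that [ord] does not give it. *)
Definition ord_ge P m f := f = 0 \/ m <= ord P f.

(** Scaling by a power of [t] turns the ultrametric inequality into closure of the local ring under
    addition. *)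
Lemma ord_ge_regular P t m f : uniformizer P t ->
  ord_ge P m f <-> regular_at P (t ^ (- m) * f).
Proof.
move=> ut; have t0 := uniformizer_neq0 ut; rewrite regular_ord.
have [->|f0] := eqVneq f 0; first by rewrite mulr0 ord_zero; split=> // _; left.
rewrite ordM ?expfz_neq0 // ordXz -[t in ord P t]mulr1 -[t]expr1z.
rewrite (ord_eq _ ut (local_unit1 P)) mul1r addrC subr_ge0; split=> [[/eqP|//]|].
  by rewrite (negPf f0).
by right.
Qed.

Lemma ord_geD P m f h : ord_ge P m f -> ord_ge P m h -> ord_ge P m (f + h).
Proof.
have [t ut] := uniformizer_exists P; rewrite !(ord_ge_regular _ _ ut) mulrDr.
exact: regularD.
Qed.

Lemma ord_geM P m n f h :
  ord_ge P m f -> ord_ge P n h -> ord_ge P (m + n) (f * h).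
Proof.
have [t ut] := uniformizer_exists P; rewrite !(ord_ge_regular _ _ ut).
by rewrite opprD expfzDr ?(uniformizer_neq0 ut) // mulrACA; apply: regularM.
Qed.

Lemma ord_ge_const P c : ord_ge P 0 (iota c).
Proof. by right; rewrite ord_const. Qed.

Lemma ord_geZ P m c f : ord_ge P m f -> ord_ge P m (iota c * f).
Proof. by move=> fm; rewrite -[m]add0r; apply: ord_geM (ord_ge_const P c) fm. Qed.

Lemma ord_geW P m n f : m <= n -> ord_ge P n f -> ord_ge P m f.
Proof. by move=> mn [->|nf]; [left | right; apply: le_trans nf]. Qed.

Lemma ord_ge0 P f : ord_ge P 0 f <-> regular_at P f.
Proof.
rewrite regular_ord; split=> [[->|//]|]; first by rewrite ord_zero.
by right.
Qed.

Lemma regular_root P (n' : nat) f : (0 < n')%N -> regular_at P (f ^+ n') -> regular_at P f.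
Proof.
by rewrite !regular_ord ordX => n0; rewrite pmulrn_lge0.
Qed.

Lemma ord_subC_pole P f c : ord P f < 0 -> ord P (f - iota c) = ord P f.
Proof.
move=> pf; have f0 : f != 0 by apply: contraTneq pf => ->; rewrite ord_zero.
have -> : f - iota c = f * (1 - iota c * f^-1).
  by rewrite mulrBr mulr1 mulrCA mulfV // mulr1.
have u1 : local_unit P (1 - iota c * f^-1).
  exists 1; first exact: oner_neq0.
  rewrite -[X in has_value P _ X]subr0; apply: has_valueB (has_value1 P) _.
  rewrite mulrC; apply: vanish_mul (has_value_const P c); apply/value0_ord.
    by rewrite invr_eq0.
  by rewrite ordV oppr_gt0.
by rewrite ordM ?(local_unit_neq0 u1) // (ord_unit u1) addr0.
Qed.

Lemma pole_subC P f c : (ord P (f - iota c) < 0) = (ord P f < 0).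
Proof.
apply/idP/idP => o0; last by rewrite ord_subC_pole.
have := o0; rewrite -(ord_subC_pole (- c) o0) rmorphN opprK subrK.
by [].
Qed.

End Valuation.

(** * Riemann-Roch spaces *)

Section LinearDependence.

Context (F K : fieldType) (iota : {rmorphism F -> K}).

Definition lindep (I : finType) (f : I -> K) : Prop :=
  exists2 c : I -> F, exists i, c i != 0 & \sum_i iota (c i) * f i = 0.

(** An upper bound on the dimension that asks for no basis and is inherited by subspaces. *)
Definition dim_le (V : K -> Prop) (n : nat) : Prop :=
  forall f : 'I_n.+1 -> K, (forall i, V (f i)) -> lindep f.

Lemma dim_le_lindep V n (I : finType) (f : I -> K) :
  dim_le V n -> (n < #|I|)%N -> (forall i, V (f i)) -> lindep f.
Proof.
move=> dV nI Vf; pose s (i : 'I_n.+1) : I := enum_val (widen_ord nI i).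
have injs : injective s by move=> i j /enum_val_inj /(congr1 val) /= /val_inj.
have [i|c [i ci] E] := dV (f \o s); first exact: Vf.
exists (fun x => \sum_(j | s j == x) c j).
  exists (s i); rewrite (eq_bigl (pred1 i)) ?big_pred1_eq // => j.
  exact: (inj_eq injs).
rewrite -[RHS]E [RHS](partition_big s xpredT) //=; apply: eq_bigr => x _.
by rewrite rmorph_sum mulr_suml; apply: eq_bigr => j /eqP ->.
Qed.

Lemma has_dim_le (E V : K -> Prop) n :
  (forall f, E f <-> exists c, f = iota c) -> has_dim E V n -> dim_le V n.
Proof.
move=> EP [b [Vb _ spb]] f Vf.
have /choice [c cE] : forall i, exists c : 'I_n -> F,
    f i = \sum_j iota (c j) * b j.
  move=> i; have [c [Ec ->]] := spb _ (Vf i).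
  have /choice [c' cE] : forall j, exists c', c j = iota c'.
    by move=> j; apply/EP.
  by exists c'; apply: eq_bigr => j _; rewrite cE.
pose A := \matrix_(i, j) c i j.
have : kermx A != 0.
  by rewrite kermx_eq0; apply/eqP => rA; have := rank_leq_col A; rewrite rA ltnn.
case/rowV0Pn => w /sub_kermxP wA /rV0Pn [i wi].
exists (w 0); first by exists i.
under eq_bigr => l _ do rewrite cE mulr_sumr.
rewrite exchange_big big1 //= => j _.
under eq_bigr => l _ do rewrite mulrA -rmorphM.
rewrite -mulr_suml -rmorph_sum /=.
have := congr1 (fun B : 'rV_n => B 0 j) wA; rewrite !mxE => E0.
rewrite (_ : \sum_i _ = 0) ?rmorph0 ?mul0r // -[RHS]E0.
by apply: eq_bigr => l _; rewrite mxE.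
Qed.

Lemma lindep_lift n (f : 'I_n.+1 -> K) i0 (a : 'I_n -> F) :
  lindep (fun j => f (lift i0 j) - iota (a j) * f i0) -> lindep f.
Proof.
move=> [c [j cj] E].
pose c' i := if unlift i0 i is Some l then c l else - \sum_l c l * a l.
exists c'; first by exists (lift i0 j); rewrite /c' liftK.
rewrite (bigD1_ord i0) //= /c' unlift_none rmorphN mulNr rmorph_sum mulr_suml.
rewrite -sumrN -big_split -[RHS]E; apply: eq_bigr => l _ /=.
by rewrite liftK rmorphM; ring.
Qed.

(** The hypothesis says that [V1] modulo [V0] has dimension at most one. A member of the family
    outside [V0] serves as pivot, and multiples of it move the other members into [V0]. *)
Lemma dim_le_step (V0 V1 : K -> Prop) n :
  (forall f h, V1 f -> V1 h -> ~ V0 h -> exists a, V0 (f - iota a * h)) ->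
  dim_le V0 n -> dim_le V1 n.+1.
Proof.
move=> step d0 f V1f.
have [V0f|/existsNP [i0 nV0]] := pselect (forall i, V0 (f i)).
  apply: (@lindep_lift _ _ 0 (fun=> 0)); apply: d0 => i.
  by rewrite rmorph0 mul0r subr0.
have /choice [a aE] : forall j, exists a, V0 (f (lift i0 j) - iota a * f i0).
  by move=> j; apply: step.
by apply: (@lindep_lift _ _ i0 a); apply: d0.
Qed.

Lemma dim_le0 : dim_le (fun f => f = 0) 0.
Proof.
move=> f f0; exists (fun=> 1); first by exists 0; rewrite oner_eq0.
by rewrite big_ord1 f0 mulr0.
Qed.

End LinearDependence.

Section RiemannSpaces.

Context (k : closedFieldType) (C : smooth_projective_curve k).

Local Notation kC := (funfield C).
Local Notation iota := (const C).
Local Notation peval := (peval iota).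

Implicit Types (P : point C) (f h t : kC) (S : seq (point C)).

Lemma deg_sum (D : divisor C) : deg D = \sum_(P <- dom D) coeff P D.
Proof.
rewrite -{1}[D]freeg_sumE raddf_sum; apply: eq_bigr => P _.
exact: degU.
Qed.

Lemma const_of_lindep f n :
  lindep iota (fun i : 'I_n => f ^+ i) -> is_const f.
Proof.
move=> [c [i ci] E]; apply: closed_algebraic.
exists (\poly_(i < n) (if insub i is Some j then c j else 0)).
  apply/eqP => /polyP /(_ i); rewrite coef_poly coef0 ltn_ord valK => c0.
  by rewrite c0 eqxx in ci.
apply/eqP; rewrite (@horner_coef_wide _ n) ?size_map_poly ?size_poly //.
rewrite -[RHS]E; apply: eq_bigr => j _.
by rewrite coef_map coef_poly ltn_ord valK.
Qed.

(** For nonconstant [f], the product [G] of powers of [f - f(P)] over the support of [A] vanishes to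
    order at least [|A(P)|] at each such [P]. So [L(A)] contains [G] whatever the signs in [A], and
    with it all the [G * f ^+ i]. *)
Lemma finite_Lspace_const (A : divisor C) l f :
  has_dim (@is_const _ C) (RRspace A) l -> (forall P, regular_at P f) ->
  is_const f.
Proof.
move=> dA rf; have [//|nf] := pselect (is_const f).
pose a P := projT1 (cid (rf P)).
have va P : has_value P f (a P) by rewrite /a; case: cid.
have f0 P : f - iota (a P) != 0.
  by apply: contra_notN nf; rewrite subr_eq0 => /eqP ->; exists (a P).
have rfa Q P : 0 <= ord Q (f - iota (a P)).
  by apply/regular_ord/regularB => //; apply: regular_const.
pose G := \prod_(P <- dom A) (f - iota (a P)) ^+ `|coeff P A|.
have oG Q : ord Q G = \sum_(P <- dom A) ord Q (f - iota (a P)) *+ `|coeff P A|.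
  rewrite ord_prod => [|P _]; last by rewrite expf_neq0.
  by apply: eq_bigr => P _; rewrite ordX.
have G0 : G != 0.
  apply: (big_ind (fun y => y != 0)) => [||P _]; first exact: oner_neq0.
    by move=> *; apply: mulf_neq0.
  by rewrite expf_neq0.
have f_neq0 : f != 0.
  by apply: contra_notN nf => /eqP ->; exists 0; rewrite rmorph0.
have [i|c [i ci] E] := has_dim_le (iota := iota) (fun=> iff_refl _) dA
    (f := fun i => G * f ^+ i).
  right=> Q; rewrite ordM ?expf_neq0 // ordX.
  have : 0 <= ord Q f *+ i by apply: mulrn_wge0; apply/regular_ord.
  suff : 0 <= ord Q G + coeff Q A by lia.
  have [Qd|/coeff_outdom ->] := boolP (Q \in dom A); last first.
    by rewrite addr0 oG; apply: sumr_ge0 => P _; apply: mulrn_wge0.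
  rewrite oG (big_rem Q) //=.
  have : 0 <= \sum_(P <- rem Q (dom A)) ord Q (f - iota (a P)) *+ `|coeff P A|.
    by apply: sumr_ge0 => P _; apply: mulrn_wge0.
  have : (1 : int) *+ `|coeff Q A| <= ord Q (f - iota (a Q)) *+ `|coeff Q A|.
    apply: ler_wMn2r; suff: 0 < ord Q (f - iota (a Q)) by [].
    apply/value0_ord => //; rewrite -(subrr (a Q)).
    by apply: has_valueB => //; apply: has_value_const.
  rewrite natz; move: (_ *+ _) (\sum_(_ <- _) _) => o1 o2; lia.
apply: (@const_of_lindep _ l.+1); exists c; first by exists i.
apply: (mulfI G0); rewrite mulr0 -[RHS]E mulr_sumr; apply: eq_bigr => j _.
by rewrite mulrCA.
Qed.

Lemma genus_regular_const g f : has_genus C g ->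
  (forall P, regular_at P f) -> is_const f.
Proof. by move=> [[A [l [dA _]]] _]; apply: finite_Lspace_const dA. Qed.

(** [L] of the effective divisor in which each point has its multiplicity in [S]; a list allows
    induction by one point at a time. *)
Definition Lspace S f := forall P, ord_ge P (- (count_mem P S)%:Z) f.

(** Being outside [Lspace S], [h] has the largest pole allowed at [P]. Hence [f / h] is regular
    there, and subtracting its value [a] gains one order. *)
Lemma Lspace_step P S f h : Lspace (P :: S) f -> Lspace (P :: S) h ->
  ~ Lspace S h -> exists a, Lspace S (f - iota a * h).
Proof.
move=> Lf Lh nLh; set m := count_mem P S.
have out Q f' : Q != P -> Lspace (P :: S) f' -> ord_ge Q (- (count_mem Q S)%:Z) f'.
  by move=> QP /(_ Q); rewrite /= eq_sym (negPf QP) add0n.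
have nP : ~ ord_ge P (- m%:Z) h.
  move=> hP; apply: nLh => Q; have [->//|QP] := eqVneq Q P.
  exact: out.
have := Lh P; have := Lf P; rewrite /= eqxx -/m => fP hP.
have h0 : h != 0 by apply: contra_notN nP => /eqP ->; left.
have oh : ord P h = - (m.+1)%:Z.
  case: hP => [h00|]; first by rewrite h00 eqxx in h0.
  have : ~ (- m%:Z <= ord P h) by move=> mh; apply: nP; right.
  by lia.
have [a va] : regular_at P (f / h).
  apply/ord_ge0; rewrite -(subrr (- (m.+1)%:Z)); apply: ord_geM => //.
  by right; rewrite ordV oh.
exists a => Q; have [->|QP] := eqVneq Q P; last first.
  apply: ord_geD; first exact: out.
  by rewrite -mulNr -rmorphN; apply/ord_geZ/out.
rewrite (_ : f - iota a * h = (f / h - iota a) * h); last by field.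
rewrite (_ : - (count_mem P S)%:Z = 1 + ord P h); last by rewrite oh -/m; lia.
apply: ord_geM; last by right.
have [fh|fh] := eqVneq (f / h - iota a) 0; [by left | right].
suff: 0 < ord P (f / h - iota a) by [].
apply/value0_ord => //; rewrite -(subrr a).
by apply: has_valueB => //; apply: has_value_const.
Qed.

Lemma Lspace_dim (complete : forall f, (forall P, regular_at P f) -> is_const f) S :
  dim_le iota (Lspace S) (size S).+1.
Proof.
elim: S => [|P S IH]; last exact: dim_le_step (@Lspace_step P S) IH.
apply: dim_le_step (dim_le0 iota) => f h Lf Lh h0.
have cst f' : Lspace [::] f' -> is_const f'.
  by move=> Lf'; apply: complete => P; apply/ord_ge0/Lf'.
have [a fE] := cst _ Lf; have [b hE] := cst _ Lh.
exists (a / b); rewrite fE hE fmorph_div divfK ?subrr //.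
by rewrite -hE; apply/eqP.
Qed.

End RiemannSpaces.

(** * Eigenvectors and integrality *)

Lemma sum_unity_root (F : fieldType) (x : F) n :
  x ^+ n = 1 -> x != 1 -> \sum_(m < n) x ^+ m = 0.
Proof.
move=> xn x1; have := subrX1 x n; rewrite xn subrr => /esym/eqP.
by rewrite mulf_eq0 subr_eq0 (negPf x1) => /eqP.
Qed.

Section Eigenvectors.

Context (k K : fieldType) (iota : {rmorphism k -> K}) (s : {rmorphism K -> K}).
Hypothesis s_const : forall c, s (iota c) = iota c.

Lemma rmorph_peval u p : s (peval iota u p) = peval iota (s u) p.
Proof.
rewrite /peval -horner_map /= -map_poly_comp.
by congr (_.[_]); apply: eq_map_poly => y /=; rewrite s_const.
Qed.

Fixpoint rmorph_iter m : {rmorphism K -> K} :=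
  if m is m'.+1 then s \o rmorph_iter m' else idfun.

Lemma rmorph_iterE m f : rmorph_iter m f = iter m s f.
Proof. by elim: m f => //= m IH f; rewrite IH. Qed.

Lemma iter_fixed m f : s f = f -> iter m s f = f.
Proof. by move=> sf; elim: m => //= m ->. Qed.

Lemma iter_eigen m a v : s v = iota a * v -> iter m s v = iota (a ^+ m) * v.
Proof.
move=> sv; elim: m => [|m IH] /=; first by rewrite rmorph1 mul1r.
by rewrite IH rmorphM s_const sv mulrA -rmorphM exprSr.
Qed.

Lemma eigenX a v i : s v = iota a * v -> s (v ^+ i) = iota (a ^+ i) * v ^+ i.
Proof. by move=> sv; rewrite rmorphXn /= sv exprMn rmorphXn. Qed.

Context (n : nat) (z : k) (v : K).
Hypothesis prim_z : n.-primitive_root z.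
Hypothesis v0 : v != 0.
Hypothesis sv : s v = iota z * v.

Let n_gt0 : (0 < n)%N := prim_order_gt0 prim_z.

(** A discrete Fourier transform: apply the iterates of [s] to the relation, weight them by powers
    of [z ^- i0] and add. Only [n * y i0 * v ^+ i0] survives, and [n] is nonzero in [k] because a
    primitive [n]-th root exists. *)
Lemma eigen_indep (y : 'I_n -> K) : (forall i, s (y i) = y i) ->
  \sum_i y i * v ^+ i = 0 -> forall i, y i = 0.
Proof.
move=> sy E i0.
have Em (m : 'I_n) : \sum_(i < n) iota ((z ^+ i) ^+ m) * (y i * v ^+ i) = 0.
  have := congr1 (rmorph_iter m) E; rewrite rmorph0 rmorph_sum => Em.
  rewrite -[RHS]Em; apply: eq_bigr => i _; rewrite rmorphM !rmorph_iterE iter_fixed //.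
  by rewrite (iter_eigen m (eigenX i sv)) mulrCA.
have z0 : z != 0 by rewrite (prim_root_eq0 prim_z) -lt0n.
have : \sum_(m < n) iota ((z ^- i0) ^+ m) *
   (\sum_(i < n) iota ((z ^+ i) ^+ m) * (y i * v ^+ i)) = 0.
  by apply: big1 => m _; rewrite Em mulr0.
under eq_bigr => m _ do rewrite mulr_sumr.
rewrite exchange_big /= (bigD1 i0) //= [X in _ + X]big1 ?addr0 => [|i ii0].
  under eq_bigr => m _ do
    rewrite mulrA -rmorphM -exprMn mulVf ?expf_neq0 // expr1n rmorph1 mul1r.
  rewrite sumr_const card_ord -mulr_natl => /eqP.
  rewrite !mulf_eq0 -(rmorph_nat iota) fmorph_eq0.
  by rewrite (negPf (prim_root_natf_neq0 prim_z)) expf_eq0 (negPf v0) andbF orbF => /eqP.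
under eq_bigr => m _ do rewrite mulrA -rmorphM -exprMn.
rewrite -mulr_suml -rmorph_sum /= sum_unity_root ?rmorph0 ?mul0r //.
  rewrite exprMn exprVn -!exprM ![(_ * n)%N]mulnC !exprM.
  by rewrite (prim_expr_order prim_z) !expr1n invr1 mul1r.
rewrite mulrC; apply/eqP => /(congr1 ( *%R^~ (z ^+ i0))).
rewrite /= mul1r divfK ?expf_neq0 // => /eqP.
by rewrite (eq_prim_root_expr prim_z) !modn_small // => /eqP/val_inj/eqP; rewrite (negPf ii0).
Qed.

End Eigenvectors.

Lemma count_flatten_nseq (T : eqType) (x : T) m (S : seq T) :
  count_mem x (flatten (nseq m S)) = (m * count_mem x S)%N.
Proof. by elim: m => //= m IH; rewrite count_cat IH mulSn. Qed.

Lemma size_flatten_nseq (T : Type) m (S : seq T) :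
  size (flatten (nseq m S)) = (m * size S)%N.
Proof. by elim: m => //= m IH; rewrite size_cat IH mulSn. Qed.

(** * Functions regular away from the poles of [u] *)

Section AffinePart.

Context (k : closedFieldType) (C : smooth_projective_curve k).

Local Notation kC := (funfield C).
Local Notation iota := (const C).
Local Notation peval := (peval iota).

Implicit Types (P : point C) (f h : kC) (S : seq (point C)).

Context (u : kC).

Lemma integral_const c : integralOver (peval u) (iota c).
Proof. by rewrite -(pevalC iota u); apply: integral_id. Qed.

Lemma integral_rmorph_fixed (s : {rmorphism kC -> kC}) f :
  (forall c, s (iota c) = iota c) -> s u = u ->
  integralOver (peval u) f -> integralOver (peval u) (s f).
Proof.
move=> s_const su [A monA rA]; exists A => //.
have := rmorph_root s rA; congr (root _ _).
apply/polyP => i; rewrite !coef_map /=.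
by rewrite rmorph_peval // su.
Qed.

(** The local ring is integrally closed: if [f] had a pole, [f^-1] would be regular, and the monic
    equation divided by a power of [f] would express [f] as a polynomial in [f^-1] with regular
    coefficients. *)
Lemma integral_regular P f : integralOver (peval u) f -> regular_at P u ->
  regular_at P f.
Proof.
move=> [A monA rA] [a va].
have [//|nf] := pselect (regular_at P f).
have f0 : f != 0.
  by apply: contra_notN nf => /eqP ->; exists 0; apply: has_value0.
have rf : regular_at P f^-1.
  by apply/regular_ord; rewrite ordV; move/regular_ord: nf; lia.
have ra i : regular_at P (peval u A`_i).
  by exists (A`_i).[a]; apply: has_value_horner.
case sA: (size A) => [|m]; first by move: (monic_neq0 monA); rewrite -size_poly_eq0 sA.
have mE : map_poly (peval u) A = \sum_(i < m.+1) (peval u A`_i) *: 'X^i.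
  rewrite -[LHS]coefK poly_def size_map_poly_id0; last first.
    by rewrite (monicP monA) rmorph1 oner_eq0.
  by rewrite sA; apply: eq_bigr => i _; rewrite coef_map.
move: rA; rewrite /root mE horner_sum big_ord_recr /=.
have -> : A`_m = 1 by move/monicP: monA; rewrite /lead_coef sA.
rewrite rmorph1 scale1r hornerXn addrC addr_eq0 => /eqP E.
case: m sA mE E => [|m] sA mE E.
  by move: E; rewrite big_ord0 oppr0 => /eqP; rewrite oner_eq0.
have -> : f = - \sum_(i < m.+1) peval u A`_i * (f^-1) ^+ (m - i).
  apply: (mulfI (expf_neq0 m f0)); rewrite -exprSr E mulrN mulr_sumr.
  congr (- _); apply: eq_bigr => i _; rewrite hornerZ hornerXn mulrCA exprVn.
  congr (_ * _); have im : (i <= m)%N by rewrite -ltnS.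
  by rewrite -{2}(subnK im) exprD mulrAC mulfV ?mul1r ?expf_neq0.
rewrite -sub0r; apply: regularB; first by exists 0; apply: has_value0.
by apply: regular_sum => i _; apply: regularM => //; apply: regularX.
Qed.

Definition affine_regular f := forall P, regular_at P u -> regular_at P f.

Lemma affine_regular_peval p : affine_regular (peval u p).
Proof. by move=> P [a va]; exists p.[a]; apply: has_value_horner. Qed.

Context (S : seq (point C)).
Hypothesis S_poles : forall P, (count_mem P S)%:Z = Num.max 0 (- ord P u).

Local Notation L m := (Lspace (flatten (nseq m S))).

Lemma LspaceP m f : L m f <-> forall P, ord_ge P (- (m * count_mem P S)%:Z) f.
Proof. by split=> Lf P; have := Lf P; rewrite count_flatten_nseq. Qed.

Lemma LspaceM m m' f h : L m f -> L m' h -> L (m + m') (f * h).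
Proof.
move=> /LspaceP Lf /LspaceP Lh; apply/LspaceP => P.
by rewrite mulnDl PoszD opprD; apply: ord_geM.
Qed.

Lemma LspaceX m f i : L m f -> L (i * m) (f ^+ i).
Proof.
move=> Lf; elim: i => [|i IH]; last by rewrite exprS mulSn; apply: LspaceM.
by apply/LspaceP => P; rewrite expr0; right; rewrite ord_one.
Qed.

Lemma LspaceW m m' f : (m <= m')%N -> L m f -> L m' f.
Proof.
move=> mm /LspaceP Lf; apply/LspaceP => P; apply: ord_geW (Lf P).
by rewrite lerN2 lez_nat leq_mul2r mm orbT.
Qed.

Lemma Lspace_u : L 1 u.
Proof. by apply/LspaceP => P; right; rewrite mul1n S_poles; lia. Qed.

Lemma affine_regular_Lspace f : affine_regular f -> exists m, L m f.
Proof.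
move=> rf; exists (\sum_(P <- S) `|ord P f|)%N; apply/LspaceP => P.
have [PS|PS] := boolP (P \in S); last first.
  rewrite (count_memPn PS) muln0; apply/ord_ge0/rf/regular_ord.
  by have := S_poles P; rewrite (count_memPn PS); lia.
right; rewrite (big_rem P) //=.
have : (0 < count_mem P S)%N by rewrite -has_count has_pred1.
set c := count_mem P S; set o := ord P f; move: (\sum_(_ <- _) _)%N => m c0.
nia.
Qed.

(* The functions [u^j v^i] already fill [L (M S)] up to bounded codimension,
   so the powers of [f] are dependent modulo the span of the [u^j v^i]. *)
Lemma affine_regular_integral (s : {rmorphism kC -> kC}) n z v f
    (complete : forall h, (forall P, regular_at P h) -> is_const h) :
  ~ is_const u -> size S = n ->
  (forall c, s (iota c) = iota c) -> s u = u ->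
  n.-primitive_root z -> v != 0 -> s v = iota z * v ->
  integralOver (peval u) v -> affine_regular f -> integralOver (peval u) f.
Proof.
move=> nu szS s_const su prim_z v0 sv int_v rf.
have n_gt0 := prim_order_gt0 prim_z.
have rv : affine_regular v by move=> P; apply: integral_regular.
have [m0 Lf] := affine_regular_Lspace rf.
have [m1 Lv] := affine_regular_Lspace rv.
have {Lv} : exists m1, forall i : 'I_n, L m1 (v ^+ i).
  exists (n * m1)%N => i; apply: LspaceW (LspaceX i Lv).
  by rewrite leq_mul2r ltnW ?orbT.
move=> [{}m1 Lv]; have {}Lf : L m0.+1 f by apply: LspaceW Lf.
move: (m0.+1) (ltn0Sn m0) Lf => {}m0 m0_gt0 Lf.
(* [M] bounds the poles of the first [T] powers of [f], and [J = M - m1] keeps [u ^+ j * v ^+ i]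
   within the same bound. The family has [n * J + T = n * M + 2] members, one more than the
   dimension bound [n * M + 1]. Positivity of [m0] gives [m1 <= M]. *)
pose T := (n * m1).+2; pose J := (T * m0 - m1)%N; pose M := (T * m0)%N.
have m1M : (m1 <= M)%N by rewrite /M /T; nia.
pose I : finType := ('I_n * 'I_J + 'I_T)%type.
pose F (x : I) := match x with
  | inl ij => u ^+ ij.2 * v ^+ ij.1 | inr t => f ^+ t.+1 end.
have cardI : (M * n + 1 < #|{: I}|)%N.
  by rewrite card_sum card_prod !card_ord /J -/M /T; nia.
have LF x : L M (F x).
  case: x => [[i j]|t] /=.
    have -> : M = (j * 1 + (M - j))%N.
      by rewrite muln1 subnKC // ltnW // (leq_trans (ltn_ord j)) // leq_subr.
    apply: LspaceM; first exact/LspaceX/Lspace_u.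
    apply: LspaceW (Lv i); have := ltn_ord j; rewrite /J -/M; lia.
  by apply: LspaceW (LspaceX t.+1 Lf); rewrite leq_mul2r ltn_ord orbT.
have dimM := @Lspace_dim _ _ complete (flatten (nseq M S)).
rewrite size_flatten_nseq szS -addn1 in dimM.
have [c [x cx]] := dim_le_lindep dimM cardI LF; rewrite big_sumType /= => E.
pose p (i : 'I_n) : {poly k} :=
  \poly_(j < J) (if insub j is Some j' then c (inl (i, j')) else 0).
pose B : {poly k} := \poly_(t < T) (if insub t is Some t' then c (inr t') else 0).
have peval_poly y m (a : 'I_m -> k) :
    peval y (\poly_(j < m) (if insub j is Some j' then a j' else 0)) =
    \sum_j iota (a j) * y ^+ j.
  rewrite pevalE (@horner_coef_wide _ m) ?size_map_poly ?size_poly //.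
  by apply: eq_bigr => j _; rewrite coef_map coef_poly ltn_ord valK.
have {E} : \sum_i peval u (p i) * v ^+ i + peval f ('X * B) = 0.
  rewrite -[RHS]E; congr (_ + _).
    transitivity (\sum_(i < n) \sum_(j < J) iota (c (inl (i, j))) * (u ^+ j * v ^+ i)).
      2: by rewrite pair_bigA; apply: eq_bigr => -[].
    apply: eq_bigr => i _; rewrite peval_poly mulr_suml; apply: eq_bigr => j _.
    by rewrite mulrA.
  rewrite rmorphM /= pevalX peval_poly mulr_sumr; apply: eq_bigr => t _.
  by rewrite exprS mulrCA.
(* Without powers of [f] the relation would contradict the independence of the [v ^+ i] over
   functions fixed by [s]. *)
have [B0|B0] := eqVneq B 0.
  rewrite B0 mulr0 rmorph0 addr0 => E.
  have p0 i : p i = 0.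
    have := eigen_indep s_const prim_z v0 sv _ E.
    move=> E0; apply/eqP; rewrite -(peval_eq0 _ (nonconst_transcendental nu)).
    by apply/eqP/E0 => j; rewrite rmorph_peval // su.
  case/negP: cx; apply/eqP; case: x => [[i j]|t].
    by have := congr1 (fun q : {poly k} => q`_j) (p0 i); rewrite coef_poly ltn_ord valK coef0.
  by have := congr1 (fun q : {poly k} => q`_t) B0; rewrite coef_poly ltn_ord valK coef0.
move=> /eqP; rewrite addrC addr_eq0 => /eqP E.
set y := - _ in E.
have int_y : integralOver (peval u) y.
  apply: integral_opp; apply: (big_ind (integralOver (peval u))).
  - exact: integral0.
  - by move=> *; apply: integral_add.
  - move=> i _; apply: integral_mul; first exact: integral_id.
    rewrite -(hornerXn v i); apply: integral_horner int_v.
    apply/integral_poly => j; rewrite coefXn; case: eqP => _.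
      exact: integral1.
    exact: integral0.
(* The powers of [f] start at exponent 1, so [A] has positive degree. Subtracting the integral
   element [y] from its constant term then leaves the leading coefficient alone. *)
pose A := 'X * B; have A0 : A != 0 by rewrite mulf_neq0 ?polyX_eq0.
have szA : (1 < size A)%N.
  rewrite size_mul ?polyX_eq0 // size_polyX /=.
  by move: B0; rewrite -size_poly_gt0.
pose a := (lead_coef A)^-1.
have a0 : a != 0 by rewrite invr_eq0 lead_coef_eq0.
pose G := map_poly iota (a *: A) - (iota a * y)%:P.
apply: (@integral_root_monic _ _ _ _ G).
- rewrite monicE /G lead_coefDl; last first.
    rewrite size_opp size_map_poly size_scale //.
    exact: leq_ltn_trans (size_polyC_leq1 _) szA.
  by rewrite lead_coef_map lead_coefZ mulVf ?lead_coef_eq0 // rmorph1.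
- rewrite /root hornerD hornerN hornerC -/(peval f (a *: A)) pevalZ E.
  by rewrite subrr.
- apply/integral_poly => i; rewrite coefD coefN coef_map coefC.
  apply: integral_sub; first exact: integral_const.
  case: eqP => _; last exact: integral0.
  by apply: integral_mul => //; apply: integral_const.
Qed.

End AffinePart.

(** * Counting the points of a fibre *)

Section FibreCount.

Context (k : closedFieldType) (C : smooth_projective_curve k).

Local Notation kC := (funfield C).
Local Notation iota := (const C).
Local Notation peval := (peval iota).

Hypothesis complete : forall h : kC, (forall P, regular_at P h) -> is_const h.

Context (u v : kC) (s : {rmorphism kC -> kC}) (n : nat) (z : k).
Hypothesis u_nonconst : ~ is_const u.
Hypothesis s_const : forall c, s (iota c) = iota c.
Hypothesis su : s u = u.
Hypothesis prim_z : n.-primitive_root z.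
Hypothesis v0 : v != 0.
Hypothesis sv : s v = iota z * v.

Context (S : seq (point C)).
Hypothesis S_poles : forall P, (count_mem P S)%:Z = Num.max 0 (- ord P u).
Hypothesis size_S : size S = n.

Context (b : k) (l : int) (p q : {poly k}).
Hypothesis pb : p.[b] != 0.
Hypothesis qb : q.[b] != 0.
Hypothesis vn : v ^+ n = (u - iota b) ^ l * (peval u p / peval u q).

Context (T : seq (point C)).
Hypothesis T_zeros : forall P, P \in T = (0 < ord P (u - iota b)).
Hypothesis T_neq0 : T != [::].

Let n_gt0 : (0 < n)%N := prim_order_gt0 prim_z.
Let g := gcdn n `|l|.
Let g_gt0 : (0 < g)%N. Proof. by rewrite gcdn_gt0 n_gt0. Qed.
Let n' := (n %/ g)%N.
Let nE : n = (n' * g)%N. Proof. by rewrite /n' divnK // dvdn_gcdl. Qed.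
Let l' := (l %/ g)%Z.
Let lE : l = l' * g.
Proof. by rewrite /l' divzK // dvdzE /= dvdn_gcdr. Qed.
Let w := v ^+ n' * (u - iota b) ^ (- l').
Let R := peval u p / peval u q.
Let c0 := p.[b] / q.[b].

Let peval_neq0 r : r != 0 -> peval u r != 0.
Proof. by rewrite peval_eq0 //; apply: nonconst_transcendental. Qed.

Let poly_neq0 (r : {poly k}) : r.[b] != 0 -> r != 0.
Proof. by apply: contra_neq => ->; rewrite horner0. Qed.

Let pu0 : peval u p != 0. Proof. exact/peval_neq0/poly_neq0. Qed.
Let qu0 : peval u q != 0. Proof. exact/peval_neq0/poly_neq0. Qed.

Let ub0 : u - iota b != 0.
Proof.
by rewrite subr_eq0; apply: contra_not_neq u_nonconst => ->; exists b.
Qed.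

Let wg : w ^+ g = R.
Proof.
have tl : ((u - iota b) ^ (- l')) ^+ g = (u - iota b) ^ (- l).
  by rewrite exprnP exprz_exp mulNr -lE.
rewrite /w exprMn tl -exprM -nE vn.
by rewrite -invr_expz mulrAC mulfV ?mul1r // expfz_neq0.
Qed.

Let w0 : w != 0.
Proof.
apply/eqP => w0; have := wg; rewrite w0 expr0n gtn_eqF // /R => /esym/eqP.
by rewrite mulf_eq0 invr_eq0 (negPf pu0) (negPf qu0).
Qed.

Let fibre_value P : P \in T -> has_value P u b.
Proof.
rewrite T_zeros => oP; have /(value0_ord P ub0) vP := oP.
rewrite -[u](subrK (iota b)) -[b in has_value _ _ b]add0r.
by apply: has_valueD (has_value_const P b).
Qed.

Let R_value P : P \in T -> has_value P R c0.
Proof.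
by move=> /fibre_value vu; apply: has_valueM; last apply: has_valueV => //;
  apply: has_value_horner.
Qed.

Let c0_neq0 : c0 != 0. Proof. by rewrite mulf_neq0 ?invr_eq0. Qed.

Let w_value P : P \in T -> exists2 o, has_value P w o & o ^+ g = c0.
Proof.
move=> PT; have vR := R_value PT.
have [o vo] : regular_at P w.
  by apply: (regular_root g_gt0); rewrite wg; exists c0.
exists o => //; apply: has_value_inj vR; rewrite -wg.
exact: has_value_exp.
Qed.

(** Pigeonhole: [c0] has [g] distinct [g]-th roots, and [w] takes one value at each point of [T]. *)
Let missed_root : (size T < g)%N ->
  exists2 eta, eta ^+ g = c0 & forall P, P \in T -> ~ has_value P w eta.
Proof.
move=> Tg; have prim_zn : g.-primitive_root (z ^+ n').
  by apply: dvdn_prim_root => //; rewrite dvdn_gcdl.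
have [eta0 eta0g] : exists eta0, eta0 ^+ g = c0.
  have [y] := @solve_monicpoly k g (fun i => if i == 0%N then c0 else 0) g_gt0.
  case: (g) g_gt0 => // m _; rewrite big_ord_recl /= expr0 mulr1 big1 ?addr0.
    by move=> yE; exists y.
  by move=> i _; rewrite mul0r.
have eta00 : eta0 != 0.
  by apply: contraNneq c0_neq0 => e0; rewrite -eta0g e0 expr0n gtn_eqF.
pose rs := [seq eta0 * (z ^+ n') ^+ i | i <- seq.iota 0 g].
pose a P := if pselect (exists a, has_value P w a) is left ex then projT1 (cid ex) else 0.
have Urs : uniq rs.
  rewrite map_inj_in_uniq ?iota_uniq // => i j; rewrite !mem_iota /= !add0n => ig jg.
  move/(mulfI eta00)/eqP; rewrite (eq_prim_root_expr prim_zn) !modn_small //.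
  by move/eqP.
have [eta] : exists2 eta, eta \in rs & eta \notin [seq a P | P <- T].
  apply: contrapT => nex; have: {subset rs <= [seq a P | P <- T]}.
    by move=> eta ers; apply: contrapT => /negP ne; apply: nex; exists eta.
  by move/(uniq_leq_size Urs); rewrite !size_map size_iota leqNgt Tg.
case/mapP => i _ -> ne; exists (eta0 * (z ^+ n') ^+ i).
  by rewrite exprMn eta0g -(exprM (z ^+ n')) mulnC exprM (prim_expr_order prim_zn) expr1n mulr1.
move=> P PT vw; case/negP: ne; apply/mapP; exists P => //.
rewrite /a; case: pselect => [ex|[]]; last by eexists; apply: vw.
by case: (cid ex) => a' va' /=; apply: has_value_inj vw va'.
Qed.

Let sw : s w = iota (z ^+ n') * w.
Proof.
by rewrite /w rmorphM rmorphXn /= fmorphXz rmorphB /= s_const su sv exprMn rmorphXn mulrA.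
Qed.

(** Away from the fibre, the power of [p * q] clears the poles of [w^-1], because
    [(p q / w)^g = p^(g-1) q^(g+1)]. On the fibre, the zero of [R - c0] cancels the denominator
    [u - b], since [w - eta] is a unit. *)
Let affine_pole eta : eta ^+ g = c0 ->
  (forall P, P \in T -> ~ has_value P w eta) ->
  affine_regular u
    (peval u (p * q) ^+ g * (\sum_(i < g) (iota eta / w) ^+ i) / (u - iota b)).
Proof.
move=> etag miss P ru; have rpeval r : regular_at P (peval u r).
  exact: affine_regular_peval.
have [PT|nPT] := boolP (P \in T); last first.
  rewrite mulrC; apply: regularM.
    apply/regular_ord; rewrite ordV oppr_ge0 leNgt -T_zeros.
    exact: nPT.
  rewrite mulr_sumr; apply: regular_sum => i _.
  have -> : peval u (p * q) ^+ g = peval u (p * q) ^+ (g - i) * peval u (p * q) ^+ i.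
    by rewrite -exprD subnK // ltnW.
  rewrite -mulrA -exprMn; apply: regularM; first exact/regularX/rpeval.
  rewrite mulrCA; apply: regularX; apply: regularM; first exact: regular_const.
  apply: (regular_root g_gt0); rewrite mulrC.
  have -> : (w^-1 * peval u (p * q)) ^+ g =
      peval u p ^+ g.-1 * peval u q ^+ g.+1.
    rewrite mulrC exprMn exprVn wg /R rmorphM /= -(prednK g_gt0).
    by rewrite exprMn !exprS; field; rewrite ?pu0 ?qu0.
  by apply: regularM; apply/regularX/rpeval.
have vu := fibre_value PT; have [o vo og] := w_value PT.
have oeta : o - eta != 0.
  by rewrite subr_eq0; apply: contra_not_neq (miss P PT) => <-.
have vw : has_value P (w - iota eta) (o - eta).
  by apply: has_valueB => //; apply: has_value_const.
have weta0 : w - iota eta != 0.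
  by apply: (@local_unit_neq0 _ _ P); exists (o - eta).
have [r rE] : exists r, p - c0 *: q = r * ('X - b%:P).
  apply/factor_theorem; rewrite /root hornerD hornerN hornerZ /c0.
  by rewrite divfK ?subrr.
have geom : (\sum_(i < g) (iota eta / w) ^+ i) =
    w^-1 ^+ g.-1 * ((w - iota eta)^-1 * (peval u r / peval u q)) * (u - iota b).
  have : peval u r * (u - iota b) / peval u q = R - iota c0.
    rewrite -pevalXsubC -rmorphM -rE rmorphB /= pevalZ /R; field.
    exact: qu0.
  have := subrXX w (iota eta) g; rewrite wg -rmorphXn etag => -> E.
  transitivity (w^-1 ^+ g.-1 * ((w - iota eta)^-1 *
      (peval u r * (u - iota b) / peval u q))); last first.
    by move: (w^-1 ^+ _) ((w - iota eta)^-1) ((peval u q)^-1) => *; ring.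
  rewrite E mulKf //.
  rewrite mulr_sumr; apply: eq_bigr => i _.
  have -> : w^-1 ^+ g.-1 = w^-1 ^+ (g.-1 - i) * w^-1 ^+ i.
    by rewrite -exprD subnK // -ltnS prednK.
  by rewrite exprMn !exprVn; field; rewrite !expf_neq0.
rewrite geom -!mulrA mulfV // mulr1; apply: regularM; first exact/regularX/rpeval.
apply: regularM.
  apply: regularX; exists o^-1; apply: has_valueV => //.
  by apply: contraNneq c0_neq0 => o0; rewrite -og o0 expr0n gtn_eqF.
apply: regularM; first by exists (o - eta)^-1; apply: has_valueV.
apply: regularM => //; exists (q.[b])^-1; apply: has_valueV => //.
exact: has_value_horner.
Qed.

(** The factor lies in [k[u]], so the product is still an eigenvector for [z], and it is large
    enough to make the [n]-th power a polynomial in [u]. *)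
Let kummer_integral :
  integralOver (peval u) (v * (peval u q * (u - iota b) ^+ `|l|)).
Proof.
(* The integer inside is nonnegative because [n > 0], so [absz] does not change the exponent. *)
pose m := absz (l + (`|l| * n)%N%:Z).
exists ('X^n - (('X - b%:P) ^+ m * p * q ^+ n.-1)%:P).
  by rewrite monicE lead_coefXnsubC.
rewrite rmorphB /= map_polyXn map_polyC /root !hornerE.
rewrite -[X in _ - X]/(peval u _) !rmorphM !rmorphXn /=.
rewrite pevalXsubC subr_eq0 !exprMn vn.
have -> : (u - iota b) ^+ m = (u - iota b) ^ l * ((u - iota b) ^+ `|l|) ^+ n.
  rewrite -exprM !exprnP -expfzDr //; congr (_ ^ _).
  rewrite /m; case: (l) => j; nia.
have -> : peval u q ^+ n = peval u q * peval u q ^+ n.-1.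
  by rewrite -exprS prednK.
apply/eqP.
by set X := _ ^ l; set Y := (_ ^+ `|l|) ^+ n; field.
Qed.

Lemma card_fibre_ge : (g <= size T)%N.
Proof.
rewrite leqNgt; apply/negP => /missed_root [eta etag miss].
have := affine_pole etag miss; set f := _ / _ => rf.
have int_f : integralOver (peval u) f.
  apply: (affine_regular_integral S_poles complete u_nonconst size_S s_const
    su prim_z _ _ kummer_integral rf).
    by rewrite !mulf_neq0 ?expf_neq0.
  rewrite !rmorphM rmorphXn rmorphB /= su s_const sv -mulrA; do 2!congr (_ * _).
  by rewrite rmorph_peval // su.
pose Z := \sum_(m < n) rmorph_iter s m f.
have int_Z : integralOver (peval u) Z.
  apply: (big_ind (integralOver (peval u))) => [||m _].
  - exact: integral0.
  - by move=> *; apply: integral_add.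
  apply: integral_rmorph_fixed int_f => [c|]; rewrite rmorph_iterE iter_fixed //.
(* As [w] is an eigenvector for a primitive [g]-th root of unity, summing over the iterates of [s]
   kills every term of the geometric sum but the one with [i = 0]. *)
have ZE : Z = n%:R * peval u (p * q) ^+ g / (u - iota b).
  pose zn := z ^+ n'; have prim_zn : g.-primitive_root zn.
    by apply: dvdn_prim_root => //; rewrite dvdn_gcdl.
  have fE (m : 'I_n) : rmorph_iter s m f = peval u (p * q) ^+ g / (u - iota b)
      * \sum_(i < g) iota ((zn ^- i) ^+ m) * (iota eta / w) ^+ i.
    have fix_const c : rmorph_iter s m (iota c) = iota c.
      by rewrite rmorph_iterE iter_fixed.
    have fix_u : rmorph_iter s m u = u by rewrite rmorph_iterE iter_fixed.
    rewrite /f mulrAC rmorphM fmorph_div rmorphB rmorphXn rmorph_peval //.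
    rewrite fix_u fix_const; congr (_ * _); rewrite rmorph_sum.
    apply: eq_bigr => i _; rewrite rmorphXn fmorph_div fix_const rmorph_iterE.
    rewrite (iter_eigen s_const m sw) invfM mulrCA exprMn -fmorphV -rmorphXn.
    by rewrite -!exprVn -!exprM -mulnA [(m * i)%N]mulnC.
  rewrite /Z; under eq_bigr => m _ do rewrite fE.
  rewrite -mulr_sumr exchange_big /=.
  rewrite (bigD1 (Ordinal g_gt0)) //= [X in _ * (_ + X)]big1 => [|i i0].
    under eq_bigr => m _ do rewrite expr0 invr1 expr1n rmorph1 mul1r expr0.
    by rewrite sumr_const card_ord addr0 mulrC mulrA.
  rewrite -mulr_suml -rmorph_sum /= sum_unity_root ?rmorph0 ?mul0r //.
    have zn_n : zn ^+ n = 1.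
      by rewrite nE mulnC exprM (prim_expr_order prim_zn) expr1n.
    by rewrite exprVn -exprM mulnC exprM zn_n expr1n invr1.
  rewrite invr_eq1 -(prim_order_dvd prim_zn) gtnNdvd // lt0n.
  by apply: contra i0 => /eqP i0; apply/eqP/val_inj.
have [P PT] : exists P, P \in T.
  by case: (T) T_neq0 => // P T' _; exists P; rewrite inE eqxx.
have vu := fibre_value PT.
have [y vZ] : regular_at P Z by apply: integral_regular int_Z _; exists b.
have vt : has_value P (u - iota b) 0.
  by rewrite -(subrr b); apply: has_valueB => //; apply: has_value_const.
(* Regularity of [Z] makes [(u - b) * Z] vanish on the fibre, but this product is [n (p q)^g], whose
   value at [b] is nonzero. *)
have := vanish_mul vt vZ; rewrite ZE mulrC divfK // => v1.
have v2 : has_value P (n%:R * peval u (p * q) ^+ g) (n%:R * (p * q).[b] ^+ g).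
  apply: has_valueM; last exact/has_value_exp/has_value_horner.
  by rewrite -(rmorph_nat iota); apply: has_value_const.
move/eqP: (has_value_inj v1 v2); rewrite eq_sym mulf_eq0 expf_eq0 hornerM.
by rewrite mulf_eq0 (negPf pb) (negPf qb) andbF orbF (negPf (prim_root_natf_neq0 prim_z)).
Qed.

End FibreCount.

(** * Kummer theory *)

Section KummerExtension.

Context (F K : fieldType) (emb : {rmorphism F -> K}) (n : nat) (z w : F) (v : K).
Hypothesis prim_z : n.-primitive_root z.
Hypothesis v0 : v != 0.
Hypothesis vn : v ^+ n = emb w.
Hypothesis pow_base : forall m y, v ^+ m = emb y -> (n %| m)%N.

Let n_gt0 : (0 < n)%N := prim_order_gt0 prim_z.
Let prim_ez : n.-primitive_root (emb z).
Proof. by rewrite fmorph_primitive_root. Qed.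

Lemma Xn_sub_factor :
  'X^n - (v ^+ n)%:P = \prod_(i <- iota 0 n) ('X - (emb z ^+ i * v)%:P).
Proof.
rewrite [LHS](@all_roots_prod_XsubC _ _ [seq emb z ^+ i * v | i <- iota 0 n]).
- by rewrite lead_coefXnsubC // scale1r big_map.
- by rewrite size_XnsubC // size_map size_iota.
- apply/allP => _ /mapP [i _ ->]; rewrite /root !hornerE exprMn exprAC.
  by rewrite (prim_expr_order prim_ez) expr1n mul1r subrr.
rewrite uniq_rootsE map_inj_in_uniq ?iota_uniq // => i j.
rewrite !mem_iota /= !add0n => ig jg /(mulIf v0)/eqP.
by rewrite (eq_prim_root_expr prim_ez) !modn_small // => /eqP.
Qed.

(* A factor of [X^n - w] over [F] of degree [m] has constant term
   [v^m] up to an element of [F]. *)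
Lemma kummer_minimal (A : {poly F}) : (size A <= n)%N ->
  root (map_poly emb A) v -> A = 0.
Proof.
move=> szA rA; apply/eqP; apply: contraT => A0.
pose G := gcdp A ('X^n - w%:P).
have G0 : G != 0 by rewrite gcdp_eq0 negb_and A0.
have szG : (size G <= n)%N by apply: leq_trans szA; apply: leq_gcdpl.
have mapXn : map_poly emb ('X^n - w%:P) = 'X^n - (v ^+ n)%:P.
  by rewrite rmorphB /= map_polyXn map_polyC /= vn.
have rG : root (map_poly emb G) v.
  by rewrite gcdp_map root_gcd rA mapXn /root !hornerE subrr.
have : map_poly emb G %| \prod_(i <- iota 0 n) ('X - (emb z ^+ i * v)%:P).
  by rewrite -Xn_sub_factor -mapXn dvdp_map dvdp_gcdr.
case/dvdp_prod_XsubC => m; move: (mask m _) => s /eqpf_eq [c c0 GE].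
have szs : size G = (size s).+1.
  by rewrite -(size_map_poly emb) GE size_scale // size_prod_XsubC.
have cE : c = emb (lead_coef G).
  by rewrite -lead_coef_map GE lead_coefZ (monicP (monic_prod_XsubC _ _ _)) mulr1.
have prodE : (\prod_(i <- s) ('X - (emb z ^+ i * v)%:P)).[0] =
    emb (\prod_(i <- s) - z ^+ i) * v ^+ size s.
  elim: (s) => [|i s' IH]; first by rewrite !big_nil rmorph1 hornerC mul1r expr0.
  rewrite !big_cons hornerM IH hornerXsubC sub0r rmorphM rmorphN rmorphXn /= exprS; ring.
have z0 : z != 0 by rewrite (prim_root_eq0 prim_z) -lt0n.
pose y := \prod_(i <- s) - z ^+ i.
have y0 : y != 0.
  apply: (big_ind (fun x => x != 0)) => [||i _]; first exact: oner_neq0.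
    by move=> *; apply: mulf_neq0.
  by rewrite oppr_eq0 expf_neq0.
have : v ^+ size s = emb (G.[0] / (lead_coef G * y)).
  have := congr1 (fun q : {poly K} => q.[0]) GE.
  rewrite hornerZ prodE -/y cE -(rmorph0 emb) horner_map fmorph_div rmorphM /= => ->.
  by field; rewrite !fmorph_eq0 lead_coef_eq0 G0 y0.
(* The degree of [G] is divisible by [n] and smaller than [n], so [G] would be a nonzero constant
   with the root [v]. *)
move/pow_base/dvdn_leq; rewrite szs in szG.
case: (posnP (size s)) => [s0|s_gt0]; last first.
  by move/(_ isT); rewrite leqNgt szG.
have := root_size_gt1 _ rG; rewrite map_poly_eq0 size_map_poly szs s0.
by move/(_ G0).
Qed.

(** By [kummer_minimal], [X^n - w] divides every polynomial over [F] that kills [v], and [emb z * v]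
    is another of its roots. *)
Lemma kummer_conj (A : {poly F}) : root (map_poly emb A) v ->
  root (map_poly emb A) (emb z * v).
Proof.
move=> rA; pose Q := 'X^n - w%:P.
have Q0 : Q != 0 by rewrite -size_poly_eq0 size_XnsubC.
have rQ y : y ^+ n = v ^+ n -> root (map_poly emb Q) y.
  by move=> yn; rewrite /root rmorphB /= map_polyXn map_polyC /= !hornerE yn vn subrr.
have B0 : A %% Q = 0.
  apply: kummer_minimal.
    by rewrite -ltnS -(size_XnsubC w n_gt0) ltn_modp.
  rewrite /root; move: rA; rewrite {1}(divp_eq A Q) /root rmorphD rmorphM hornerD hornerM.
  by rewrite (rootP (rQ v _)) // mulr0 add0r.
rewrite (divp_eq A Q) B0 addr0 rmorphM /= rootM rQ ?orbT //.
by rewrite exprMn (prim_expr_order prim_ez) mul1r.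
Qed.

Context (E : K -> Prop).
Hypothesis EP : forall f, E f <-> exists c, f = emb c.
Hypothesis dimE : has_dim E (fun=> True) n.

(** The [n + 1] elements [1, v, ..., v^(n-1), f] are dependent over [F], and [kummer_minimal] forces
    a nonzero coefficient at [f]. *)
Lemma kummer_span f : exists2 A : {poly F}, (size A <= n)%N & f = (map_poly emb A).[v].
Proof.
have dim_n := has_dim_le EP dimE.
have [//|c [i ci] E0] := dim_n (fun i => if unlift ord_max i is Some j then v ^+ j else f).
rewrite big_ord_recr /= unlift_none in E0.
pose A (y : 'I_n -> F) := \poly_(j < n) (if insub j is Some j' then y j' else 0).
have AE y : (map_poly emb (A y)).[v] = \sum_j emb (y j) * v ^+ j.
  rewrite (@horner_coef_wide _ n) ?size_map_poly ?size_poly //.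
  by apply: eq_bigr => j _; rewrite coef_map coef_poly ltn_ord valK.
have unl (j : 'I_n) : unlift ord_max (widen_ord (leqnSn n) j) = Some j.
  have -> : widen_ord (leqnSn n) j = lift ord_max j by apply/val_inj/esym/lift_max.
  by rewrite liftK.
rewrite (eq_bigr (fun j => emb (c (widen_ord (leqnSn n) j)) * v ^+ j)) in E0; last first.
  by move=> j _; rewrite unl.
have [c0|c0] := eqVneq (c ord_max) 0.
  rewrite c0 rmorph0 mul0r addr0 -AE in E0.
  have A0 := kummer_minimal (size_poly _ _) (introT eqP E0).
  case/negP: ci; apply/eqP; case: (unliftP ord_max i) => [j ->|->] //.
  have := congr1 (fun q : {poly F} => q`_j) A0.
  rewrite coef_poly ltn_ord valK coef0 => cj; rewrite -[RHS]cj; congr (c _).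
  by apply/val_inj/lift_max.
exists (A (fun j => - (c ord_max)^-1 * c (widen_ord (leqnSn n) j))).
  exact: size_poly.
apply: (mulfI (_ : emb (c ord_max) != 0)); first by rewrite fmorph_eq0.
move/eqP: E0; rewrite addrC addr_eq0 => /eqP ->; rewrite AE mulr_sumr -sumrN.
apply: eq_bigr => j _; rewrite rmorphM rmorphN fmorphV; field.
by rewrite fmorph_eq0.
Qed.

Definition kummer_poly f : {poly F} := projT1 (cid2 (kummer_span f)).
Let kummer_polyE f : (map_poly emb (kummer_poly f)).[v] = f.
Proof. by rewrite /kummer_poly; case: cid2. Qed.

(** Independent of the polynomial chosen to represent [f], by [kummer_conj]; this is what makes it a
    ring morphism. *)
Definition kummer_aut f : K := (map_poly emb (kummer_poly f)).[emb z * v].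

Let kummer_autE A : kummer_aut (map_poly emb A).[v] = (map_poly emb A).[emb z * v].
Proof.
apply/eqP; rewrite -subr_eq0 -hornerN -hornerD -rmorphB; apply: kummer_conj.
by rewrite /root rmorphB hornerD hornerN kummer_polyE subrr.
Qed.

Let kummer_aut_zmod : zmod_morphism kummer_aut.
Proof.
move=> f h; rewrite -{1}[f]kummer_polyE -{1}[h]kummer_polyE.
rewrite -hornerN -hornerD -rmorphB kummer_autE.
by rewrite rmorphB hornerD hornerN.
Qed.

Let kummer_aut_monoid : monoid_morphism kummer_aut.
Proof.
split; first by have := kummer_autE 1; rewrite rmorph1 -polyC1 !hornerC.
move=> f h; rewrite -{1}[f]kummer_polyE -{1}[h]kummer_polyE -hornerM -rmorphM kummer_autE.
by rewrite rmorphM hornerM.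
Qed.

HB.instance Definition _ := GRing.isZmodMorphism.Build K K kummer_aut kummer_aut_zmod.
HB.instance Definition _ := GRing.isMonoidMorphism.Build K K kummer_aut kummer_aut_monoid.

Let kummer_aut_emb c : kummer_aut (emb c) = emb c.
Proof.
have := kummer_autE c%:P; rewrite map_polyC /= !hornerC; exact.
Qed.

Let kummer_aut_v : kummer_aut v = emb z * v.
Proof. by have := kummer_autE 'X; rewrite map_polyX !hornerX. Qed.

Let iter_kummer_aut m A :
  iter m kummer_aut (map_poly emb A).[v] = (map_poly emb A).[emb (z ^+ m) * v].
Proof.
elim: m => [|m IH]; first by rewrite expr0 rmorph1 mul1r.
rewrite iterS IH -horner_map /= -map_poly_comp rmorphM /= kummer_aut_v kummer_aut_emb.
rewrite mulrA -rmorphM -exprSr; congr (_.[_]).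
by apply: eq_map_poly => c; rewrite /= kummer_aut_emb.
Qed.

Let kummer_aut_aut : is_aut_over E kummer_aut.
Proof.
split; last by move=> f /EP [c ->]; apply: kummer_aut_emb.
have sn f : iter n kummer_aut f = f.
  by rewrite -[f]kummer_polyE iter_kummer_aut (prim_expr_order prim_z) rmorph1 mul1r.
exists (iter n.-1 kummer_aut) => f.
  by rewrite -iterSr prednK.
by rewrite -iterS prednK.
Qed.

Lemma kummer_galois : is_galois E.
Proof.
split; first by exists n.
move=> f fixf; have sf : kummer_aut f = f by apply: (fixf kummer_aut).
have [A szA fE] := kummer_span f; apply/EP; exists A`_0.
(* A fixed [f] has two expansions in powers of [v] with fixed coefficients, the trivial one [f * 1]
   and the one given by [A]. Their difference [y] must vanish. *)
pose y (i : 'I_n) := emb A`_i - (if i == 0%N :> nat then f else 0).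
have := @eigen_indep _ _ emb kummer_aut kummer_aut_emb n z v prim_z v0 kummer_aut_v y.
move=> /(_ _ _ (Ordinal n_gt0)); rewrite {3}/y /= => y0.
apply/esym/eqP; rewrite -subr_eq0; apply/eqP; apply: y0.
  move=> i; rewrite /y rmorphB /= kummer_aut_emb; case: eqP; rewrite ?sf //.
  by rewrite rmorph0.
under eq_bigr => i _ do rewrite mulrBl.
have fE' : f = \sum_(i < n) emb A`_i * v ^+ i.
  rewrite {1}fE (@horner_coef_wide _ n) ?size_map_poly //.
  by apply: eq_bigr => i _; rewrite coef_map.
rewrite sumrB -fE' (bigD1 (Ordinal n_gt0)) //= big1 => [|i i0].
  by rewrite mulr1 addr0 subrr.
case: eqP => [i0'|_]; last by rewrite mul0r.
by case/negP: i0; apply/eqP/val_inj.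
Qed.

(** An automorphism over [E] multiplies [v] by some [n]-th root of unity, that is by a power of [z],
    and is determined by its effect on [v]. *)
Lemma kummer_cyclic : has_cyclic_aut_group E.
Proof.
exists kummer_aut; split=> // t [_ fixt].
have t_emb c : t (emb c) = emb c by apply/fixt/EP; exists c.
have : (t v / v) ^+ n = 1.
  by rewrite expr_div_n -rmorphXn /= vn t_emb divff // -vn expf_neq0.
case/(prim_rootP prim_ez) => m tvE; exists m => f.
have tv : t v = emb (z ^+ m) * v by rewrite rmorphXn /= -tvE divfK.
rewrite -[f]kummer_polyE iter_kummer_aut -horner_map /= tv -map_poly_comp.
by congr (_.[_]); apply: eq_map_poly => c; rewrite /= t_emb.
Qed.

End KummerExtension.

Lemma closed_prim_root (k : closedFieldType) n : [pchar k] =i pred0 ->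
  (0 < n)%N -> exists z : k, n.-primitive_root z.
Proof.
move=> char0 n_gt0; have [rs] := closed_field_poly_normal ('X^n - 1 : {poly k}).
rewrite -polyC1 lead_coefXnsubC // scale1r polyC1 => E.
have n0 : n%:R != 0 :> k by move/pcharf0P: char0 => ->; rewrite -lt0n.
have Urs : uniq rs.
  by rewrite -separable.separable_prod_XsubC -E cyclotomic.separable_Xn_sub_1.
have szrs : (n <= size rs)%N.
  by rewrite -ltnS -(size_prod_XsubC rs id) -E -polyC1 size_XnsubC.
have all_rs : all n.-unity_root rs.
  apply/allP => x xrs; apply/unity_rootP/eqP; rewrite -subr_eq0.
  have : root (\prod_(y <- rs) ('X - y%:P)) x by rewrite root_prod_XsubC.
  by rewrite -E /root !hornerE.
by have /hasP [x _ xz] := cyclic.has_prim_root n_gt0 all_rs Urs szrs; exists x.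
Qed.

(** * Cyclic extensions and their eigenvectors *)

Section CyclicExtension.

Context (k K : fieldType) (iota : {rmorphism k -> K}) (s : {rmorphism K -> K}).
Hypothesis s_const : forall c, s (iota c) = iota c.

(** Dedekind's independence of characters. Subtracting [iter N s y] times the relation at [f] from
    the relation at [f * y] removes the last iterate, and [y] is chosen to keep the coefficient
    [c i] visible. *)
Lemma dedekind_iter N : (forall i j, (i < j < N)%N -> exists y, iter i s y != iter j s y) ->
  forall c : nat -> K, (forall f, \sum_(i < N) c i * iter i s f = 0) ->
  forall i, (i < N)%N -> c i = 0.
Proof.
elim: N => [//|N IH] dist c E.
have cE i : (i < N)%N -> c i = 0.
  move=> iN; have [|y /negP ny] := dist i N; first by rewrite iN ltnS leqnn.
  have dist' i' j : (i' < j < N)%N -> exists y, iter i' s y != iter j s y.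
    by case/andP=> ij jN; apply: dist; rewrite ij ltnW.
  suff D : c i * (iter i s y - iter N s y) = 0.
    by move/eqP: D; rewrite mulf_eq0 subr_eq0 => /orP [/eqP //|/ny].
  apply: (IH dist' (fun i => c i * (iter i s y - iter N s y)) _ i iN).
  move=> f; have iterM j : iter j s (f * y) = iter j s f * iter j s y.
    by rewrite -!rmorph_iterE rmorphM.
  transitivity (\sum_(j < N) c j * iter j s (f * y)
      - (\sum_(j < N) c j * iter j s f) * iter N s y).
    by rewrite mulr_suml -sumrB; apply: eq_bigr => j _; rewrite iterM; ring.
  have /eqP := E (f * y); have /eqP := E f; rewrite !big_ord_recr /= !addr_eq0.
  move=> /eqP -> /eqP ->; rewrite (iterM N) /=; ring.
move=> i; rewrite ltnS leq_eqVlt => /orP [/eqP ->|/cE //].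
have := E 1; rewrite big_ord_recr /= big1 => [|j _]; last by rewrite cE ?mul0r.
by rewrite add0r -rmorph_iterE rmorph1 mulr1.
Qed.

(** The eigenvector is a Lagrange resolvent; Dedekind's independence provides an [f] for which it is
    nonzero. *)
Lemma eigenvector_exists N z : N.-primitive_root z ->
  (forall f, iter N s f = f) ->
  (forall m, (0 < m < N)%N -> exists y, iter m s y != y) ->
  exists2 v, v != 0 & s v = iota z * v.
Proof.
move=> prim_z sN minN.
have injs m : injective (iter m s).
  by elim: m => //= m IH x y /fmorph_inj /IH.
have dist i j : (i < j < N)%N -> exists y, iter i s y != iter j s y.
  case/andP=> ij jN; have [|y ny] := minN (j - i)%N.
    by rewrite subn_gt0 ij (leq_ltn_trans (leq_subr _ _)).
  exists y; apply: contra_neq ny => E; apply: (@injs i).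
  by rewrite -iterD subnKC ?(ltnW ij).
have N_gt0 := prim_order_gt0 prim_z.
have [f fN] : exists f, \sum_(i < N) iota (z ^- i) * iter i s f != 0.
  apply: contrapT => /forallNP nex.
  have := @dedekind_iter N dist (fun i => iota (z ^- i)) _ 0%N N_gt0.
  rewrite expr0 invr1 rmorph1 => one0; case/eqP: (oner_neq0 K); apply: one0 => f.
  by apply/eqP; apply: contraT => /(nex f).
exists (\sum_(i < N) iota (z ^- i) * iter i s f) => //.
pose G i := iota (z ^- i) * iter i s f.
have z0 : z != 0 by rewrite (prim_root_eq0 prim_z) -lt0n.
have GN : G N = G 0%N.
  by rewrite /G sN (prim_expr_order prim_z) expr0.
have : \sum_(i < N) G i.+1 = \sum_(i < N) G i.
  apply: (addrI (G 0%N)); rewrite -[in LHS]GN [RHS]addrC.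
  transitivity (\sum_(i < N.+1) G i); last by rewrite big_ord_recr /= GN.
  by rewrite big_ord_recl /= GN.
rewrite /G => E1; rewrite -[in RHS]E1 rmorph_sum mulr_sumr; apply: eq_bigr => i _.
rewrite rmorphM s_const iterS mulrA -rmorphM; congr (iota _ * _).
by rewrite exprSr invfM mulrCA mulfV ?mulr1.
Qed.

End CyclicExtension.

Lemma inverse_rmorph (K : fieldType) (s : {rmorphism K -> K}) : bijective s ->
  exists t : {rmorphism K -> K}, cancel s t /\ cancel t s.
Proof.
case=> t st ts.
have tB : zmod_morphism t by move=> x y; apply: (can_inj st); rewrite rmorphB /= !ts.
have tM : monoid_morphism t.
  split; first by rewrite -{1}(rmorph1 s) st.
  by move=> x y; apply: (can_inj st); rewrite rmorphM /= !ts.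
pose t1 := GRing.isZmodMorphism.Build K K t tB.
pose t2 := GRing.isMonoidMorphism.Build K K t tM.
by exists (HB.pack_for {rmorphism K -> K} t t1 t2).
Qed.

(** The inverse of [s] is itself a nonnegative power [s^m], so [s^(m+1)] is the identity; [N] is the
    least positive such exponent. *)
Lemma cyclic_order (K : fieldType) (E : K -> Prop) (s : {rmorphism K -> K}) :
  is_aut_over E s -> (forall t, is_aut_over E t -> exists m, t =1 iter m s) ->
  exists N, [/\ (0 < N)%N, forall f, iter N s f = f &
    forall m, (0 < m < N)%N -> exists y, iter m s y != y].
Proof.
move=> [bs fixs] gen; have [t [st ts]] := inverse_rmorph bs.
have [|m tE] := gen t.
  split; first by exists s.
  by move=> f /fixs sf; rewrite -{1}sf st.
pose Q N := (0 < N)%N && `[< forall f, iter N s f = f >].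
have exQ : exists N, Q N.
  by exists m.+1; apply/andP; split=> //; apply/asboolP => f; rewrite iterS -tE.
case: (ex_minnP exQ) => N /andP [N_gt0 /asboolP sN] minN.
exists N; split=> // m' /andP [m0 mN].
apply: contrapT => /forallNP nex; have /minN : Q m'.
  rewrite /Q m0; apply/asboolP => f; apply/eqP; apply: contraT => nf.
  by case: (nex f).
by rewrite leqNgt mN.
Qed.

(** The order [N] of [s] must be identified with the degree [n]. The powers [v ^+ j] with [j < N]
    turn out to be a basis over [E], and two bases have the same length. *)
Lemma kummer_generator (k F K : fieldType) (iota : {rmorphism k -> K})
    (emb : {rmorphism F -> K}) (E : K -> Prop) n :
  (forall m, (0 < m)%N -> exists z : k, m.-primitive_root z) ->
  (forall f, E f <-> exists c, f = emb c) -> (forall c, E (iota c)) ->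
  has_dim E (fun=> True) n -> is_galois E -> has_cyclic_aut_group E ->
  exists (s : {rmorphism K -> K}) z v,
    [/\ is_aut_over E s, n.-primitive_root z, v != 0, s v = iota z * v &
     forall f, s f = f -> E f].
Proof.
move=> primE EP E_const dimE [_ galE] [s [auts gen]].
have [N [N_gt0 sN minN]] := cyclic_order auts gen.
have [z prim_z] := primE _ N_gt0.
have s_const c : s (iota c) = iota c by apply: (proj2 auts).
have [v v0 sv] := eigenvector_exists s_const prim_z sN minN.
have fixE f : s f = f -> E f.
  move=> sf; apply: galE => t /gen [m ->]; exact: iter_fixed.
suff -> : n = N by exists s, z, v.
have E_fix f : E f -> s f = f by apply: (proj2 auts).
have z0 : z != 0 by rewrite (prim_root_eq0 prim_z) -lt0n.
have indep (c : 'I_N -> K) : (forall i, E (c i)) ->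
    \sum_i c i * v ^+ i = 0 -> forall i, c i = 0.
  by move=> Ec; apply: (eigen_indep s_const prim_z v0 sv) => i; apply/E_fix.
have dimN : has_dim E (fun=> True) N.
  exists (fun i : 'I_N => v ^+ i); split=> // f _.
  (* [G j] is [N] times the component of [f] in the eigenspace of [z ^+ j], so [G j / v ^+ j] is
     fixed by [s] and the [G j] add up to [N * f]. *)
  pose G (j : 'I_N) := \sum_(i < N) iota ((z ^- j) ^+ i) * iter i s f.
  have sG j : s (G j) = iota (z ^+ j) * G j.
    pose H i := iota ((z ^- j) ^+ i) * iter i s f.
    have HN : H N = H 0%N.
      by rewrite /H sN exprVn exprAC (prim_expr_order prim_z) expr1n invr1.
    have : \sum_(i < N) H i.+1 = \sum_(i < N) H i.
      apply: (addrI (H 0%N)); rewrite -[in LHS]HN [RHS]addrC.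
      transitivity (\sum_(i < N.+1) H i); last by rewrite big_ord_recr /= HN.
      by rewrite big_ord_recl /= HN.
    rewrite /G => E1; rewrite -[in RHS]E1 rmorph_sum mulr_sumr; apply: eq_bigr => i _.
    rewrite rmorphM s_const /H iterS mulrA -rmorphM; congr (iota _ * _).
    by rewrite exprS mulrA mulfV ?mul1r ?expf_neq0.
  exists (fun j => (N%:R)^-1 * (G j / v ^+ j)); split=> [j|].
    apply: fixE; rewrite rmorphM fmorphV rmorph_nat fmorph_div sG.
    rewrite (eigenX j sv) -mulf_div divff ?mul1r //.
    by rewrite fmorph_eq0 expf_neq0.
  have N0 : N%:R != 0 :> K by rewrite -(rmorph_nat iota) fmorph_eq0 (prim_root_natf_neq0 prim_z).
  apply: (mulfI N0); rewrite mulr_sumr.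
  under eq_bigr => j _ do rewrite -mulrA mulVKf // divfK ?expf_neq0 //.
  rewrite exchange_big /= (bigD1 (Ordinal N_gt0)) //= [X in _ + X]big1 => [|i i0].
    under eq_bigr => j _ do rewrite expr0 rmorph1 mul1r.
    by rewrite sumr_const card_ord addr0 mulr_natl.
  under eq_bigr => j _ do rewrite -exprVn exprAC.
  rewrite -mulr_suml -rmorph_sum /= sum_unity_root ?rmorph0 ?mul0r //.
    by rewrite exprAC exprVn (prim_expr_order prim_z) invr1 expr1n.
  rewrite exprVn invr_eq1 -(prim_order_dvd prim_z) gtnNdvd // lt0n.
  by apply: contra i0 => /eqP i0; apply/eqP/val_inj.
have nlindep m (b : 'I_m -> K) : (forall c : 'I_m -> K, (forall i, E (c i)) ->
    \sum_i c i * b i = 0 -> forall i, c i = 0) -> ~ lindep emb b.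
  move=> bi [c [i ci] E0]; case/negP: ci; rewrite -(fmorph_eq0 emb); apply/eqP.
  by apply: (bi (fun i => emb (c i))) => // j; apply/EP; exists (c j).
have le m m' : has_dim E (fun=> True) m -> has_dim E (fun=> True) m' -> (m <= m')%N.
  move=> [b [_ bi _]] dm'; rewrite leqNgt; apply/negP => mm.
  apply: (nlindep _ _ bi); apply: (dim_le_lindep (has_dim_le EP dm')) => //.
  by rewrite card_ord.
by apply/eqP; rewrite eqn_leq !le.
Qed.

(** * Cyclic covers of the line *)

Lemma prod_count_mem (K : fieldType) (T : eqType) (f : T -> K) (rs U : seq T) :
  uniq U -> {subset rs <= U} ->
  \prod_(x <- rs) f x = \prod_(x <- U) f x ^+ count_mem x rs.
Proof.
move=> Uu; elim: rs => [|y rs IH] sub.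
  by rewrite big_nil big1 // => x _; rewrite expr0.
rewrite big_cons IH => [|x xrs]; last by apply: sub; rewrite inE xrs orbT.
have yU : y \in U by apply: sub; rewrite inE eqxx.
rewrite !(bigD1_seq y) //= eqxx exprS -!mulrA; congr (_ * (_ * _)).
by apply: eq_bigr => x; rewrite eq_sym => /negPf ->.
Qed.

Lemma closed_nth_root (k : closedFieldType) n (c : k) : (0 < n)%N ->
  exists y, y ^+ n = c.
Proof.
move=> n_gt0.
have [y] := @solve_monicpoly k n (fun i => if i == 0%N then c else 0) n_gt0.
case: n n_gt0 => // n _; rewrite big_ord_recl /= expr0 mulr1 big1 ?addr0.
  by move=> yE; exists y.
by move=> i _; rewrite mul0r.
Qed.

Section FunctionField.

Context (k : closedFieldType) (C : smooth_projective_curve k).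

Local Notation kC := (funfield C).
Local Notation iota := (const C).
Local Notation peval := (peval iota).

Implicit Types (P : point C) (f h : kC).

(** For constant [u] the field [k(u)] is [k], and a finite extension of [k] leaves no room for a
    nonconstant function. *)
Lemma has_degree_nonconst (u : kC) n : has_degree u n -> ~ is_const u.
Proof.
move=> dimu [c uc]; have [t []] := exists_nonconst C.
have dimk := has_dim_le (iota := iota) _ dimu.
apply: (@const_of_lindep _ _ _ n.+1); apply: dimk => // f; split; last first.
  by case=> b ->; apply: adjoin_const.
elim=> [b|s|_ _ _ [b ->] _ [b' ->]|_ _ _ [b ->] _ [b' ->]|_ _ [b ->]].
- by exists b.
- by rewrite inE => /eqP ->; exists c.
- by exists (b - b'); rewrite rmorphB.
- by exists (b * b'); rewrite rmorphM.
- by exists b^-1; rewrite fmorphV.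
Qed.

Section Nonconstant.

Context (u : kC).
Hypothesis nu : ~ is_const u.

Lemma sub_const_neq0 b : u - iota b != 0.
Proof. by rewrite subr_eq0; apply: contra_not_neq nu => ->; exists b. Qed.

Lemma adjoin_sub_const b : adjoin iota [:: u] (u - iota b).
Proof.
apply: adjoin_sub; last exact: adjoin_const.
by apply: adjoin_gen; rewrite inE.
Qed.

(** The values in [U0] are put into [U] even when their exponent is 0. With the branch values as
    [U0], the product over them can be split off whole. *)
Lemma ratfun_factor (U0 : seq k) f : uniq U0 -> f != 0 -> adjoin iota [:: u] f ->
  exists c (U : seq k) (m : k -> int), [/\ uniq U, {subset U0 <= U} &
    f = iota c * \prod_(b <- U) (u - iota b) ^ m b].
Proof.
move=> uU0 f0 /adjoin1_frac [p [q [q0 fE]]].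
have [rp pE] := closed_field_poly_normal p.
have [rq qE] := closed_field_poly_normal q.
pose U := undup (rp ++ rq ++ U0).
have Uu : uniq U by apply: undup_uniq.
have lin r rs : {subset rs <= U} -> r = lead_coef r *: \prod_(y <- rs) ('X - y%:P) ->
    peval u r = iota (lead_coef r) * \prod_(b <- U) (u - iota b) ^+ count_mem b rs.
  move=> sub ->; rewrite pevalZ lead_coefZ (monicP (monic_prod_XsubC _ _ _)) mulr1.
  rewrite rmorph_prod /=; congr (_ * _).
  rewrite -(prod_count_mem (fun b => u - iota b) Uu sub).
  by apply: eq_bigr => b _; rewrite pevalXsubC.
exists (lead_coef p / lead_coef q), U, (fun b => (count_mem b rp)%:Z - (count_mem b rq)%:Z).
split=> // [b bU0|]; first by rewrite mem_undup !mem_cat bU0 !orbT.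
rewrite fE (lin p rp) // => [|b brp]; last by rewrite mem_undup !mem_cat brp.
rewrite (lin q rq) // => [|b brq]; last by rewrite mem_undup !mem_cat brq orbT.
rewrite fmorph_div -mulf_div; congr (_ * _); rewrite -prodfV -big_split /=.
by apply: eq_bigr => b _; rewrite expfzDr ?sub_const_neq0 // -invr_expz.
Qed.

Lemma zero_value P b : 0 < ord P (u - iota b) -> has_value P u b.
Proof.
move/(value0_ord P (sub_const_neq0 b)) => v0.
rewrite -[u](subrK (iota b)) -[b in has_value _ _ b]add0r.
exact: has_valueD (has_value_const P b).
Qed.

Lemma peval_unit P b (p : {poly k}) : has_value P u b -> p.[b] != 0 ->
  ord P (peval u p) = 0.
Proof. by move=> vu pb; apply: ord_unit; exists p.[b] => //; apply: has_value_horner. Qed.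

Lemma ord_sub_other P b b' : 0 < ord P (u - iota b) -> b' != b ->
  ord P (u - iota b') = 0.
Proof.
move=> /zero_value vu b'b; rewrite -pevalXsubC; apply: peval_unit vu _.
by rewrite hornerXsubC subr_eq0 eq_sym.
Qed.

Lemma ord_ratfun P b f : 0 < ord P (u - iota b) -> adjoin iota [:: u] f ->
  exists m, ord P f = m * ord P (u - iota b).
Proof.
move=> oP /adjoin1_frac [p [q [q0 ->]]]; have vu := zero_value oP.
have ordp r : peval u r != 0 -> exists m : int, ord P (peval u r) = m * ord P (u - iota b).
  move=> r0; have [m [y /implyP yb rE]] := multiplicity_XsubC r b.
  have {}yb : ~~ root y b by apply: yb; apply: contraNneq r0 => ->; rewrite rmorph0.
  exists m%:Z; rewrite rE rmorphM rmorphXn /= pevalXsubC.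
  have y0 : peval u y != 0.
    by apply: contraNneq r0 => y0; rewrite rE rmorphM /= y0 mul0r.
  rewrite ordM // ?expf_neq0 ?sub_const_neq0 // (peval_unit vu yb) add0r ordX.
  by rewrite -mulr_natl natz.
have [p0|p0] := eqVneq (peval u p) 0; first by exists 0; rewrite p0 mul0r ord_zero mul0r.
have [m mE] := ordp p p0; have [m' mE'] := ordp q q0.
by exists (m - m'); rewrite ordM ?invr_eq0 // ordV mE mE' mulrBl.
Qed.

Lemma exists_zero b : (forall f, (forall P, regular_at P f) -> is_const f) ->
  exists P, 0 < ord P (u - iota b).
Proof.
move=> complete; apply: contrapT => /forallNP noz; apply: nu.
have [|c cE] := complete (u - iota b)^-1.
  by move=> P; apply/regular_ord; rewrite ordV; move/negP: (noz P); lia.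
exists (c^-1 + b); rewrite rmorphD fmorphV -cE invrK subrK.
by [].
Qed.

Lemma pole_part_sub P b :
  Num.max 0 (- ord P (u - iota b)) = Num.max 0 (- ord P u).
Proof.
have [o0|o0] := boolP (ord P u < 0); first by rewrite ord_subC_pole.
have o1 : ~~ (ord P (u - iota b) < 0) by rewrite pole_subC.
by move: (ord P u) (ord P _) o0 o1 => m m'; lia.
Qed.

End Nonconstant.

(** Collects the factors that are units over [b] into the single fraction used in counting the
    fibre. *)
Lemma prod_peval_frac (I : finType) (Q : pred I) (u : kC) b (r : I -> {poly k}) (l : I -> int) :
  (forall i, Q i -> (r i).[b] != 0) ->
  exists p q, [/\ p.[b] != 0, q.[b] != 0 &
    \prod_(i | Q i) peval u (r i) ^ l i = peval u p / peval u q].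
Proof.
move=> rb; apply: (big_rec (fun y => exists p q, [/\ p.[b] != 0, q.[b] != 0 &
    y = peval u p / peval u q])).
  by exists 1, 1; rewrite !hornerC !oner_neq0 rmorph1 divr1.
move=> i _ Qi [p [q [pb qb ->]]]; case: (l i) => m.
  exists (r i ^+ m * p), q; rewrite hornerM horner_exp mulf_neq0 ?expf_neq0 ?rb //.
  by split=> //; rewrite rmorphM rmorphXn /= mulrA.
exists p, (r i ^+ m.+1 * q); rewrite hornerM horner_exp mulf_neq0 ?expf_neq0 ?rb //.
split=> //; rewrite rmorphM rmorphXn /= NegzE -exprnN invfM.
by rewrite mulrCA mulrA.
Qed.

(** * Fibres that are multiples of a reduced divisor *)

Section ReducedDivisor.

Context (D : divisor C) (e : nat) (f : kC).
Hypothesis D_red : reduced_effective D.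

Lemma reduced_coeff P : coeff P D = (P \in dom D)%:Z.
Proof. by rewrite mem_dom; case: (D_red P) => ->. Qed.

Lemma reduced_deg d : deg D = d%:Z -> size (dom D) = d.
Proof.
rewrite deg_sum big_seq (eq_bigr (fun=> 1)); last first.
  by move=> P PD; rewrite reduced_coeff PD.
by rewrite -big_seq big_const_seq count_predT iter_addr addr0 natz => -[].
Qed.

Lemma reduced_fibre_size d : deg D = d%:Z ->
  size (flatten (nseq e (dom D))) = (e * d)%N.
Proof. by move=> /reduced_deg <-; rewrite size_flatten_nseq. Qed.

Lemma reduced_point d : deg D = d%:Z -> (0 < d)%N -> exists P, P \in dom D.
Proof.
move=> /reduced_deg <-; case: (dom D) => // P s _.
by exists P; rewrite inE eqxx.
Qed.

Hypothesis D_fibre : forall P, coeff P (D *+ e) = Num.max 0 (ord P f).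

Lemma reduced_fibre P : Num.max 0 (ord P f) = (e * (P \in dom D))%N%:Z.
Proof. by rewrite -D_fibre coeffMn reduced_coeff -mulr_natr natz PoszM mulrC. Qed.

Lemma reduced_fibre_list P :
  (count_mem P (flatten (nseq e (dom D))))%:Z = Num.max 0 (ord P f).
Proof.
by rewrite count_flatten_nseq (count_uniq_mem _ (uniq_dom D)) reduced_fibre.
Qed.

Hypothesis e_gt0 : (0 < e)%N.

Lemma reduced_dom P : (P \in dom D) = (0 < ord P f).
Proof. by have := reduced_fibre P; case: (P \in dom D); lia. Qed.

Lemma reduced_ord P : P \in dom D -> ord P f = e%:Z.
Proof. by move=> PD; have := reduced_fibre P; rewrite PD; lia. Qed.

End ReducedDivisor.

End FunctionField.

Lemma max0B (m : int) : Num.max 0 m - Num.max 0 (- m) = m.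
Proof. lia. Qed.

Lemma gt0_le1 (m : int) : 0 < m -> ~ 1 < m -> m = 1.
Proof. lia. Qed.

(** * The two implications for a cyclic cover *)

Section CyclicCover.

Context (k : closedFieldType) (C : smooth_projective_curve k).

Local Notation kC := (funfield C).
Local Notation iota := (const C).
Local Notation peval := (peval iota).

Hypothesis char0 : [pchar k] =i pred0.
Hypothesis complete : forall f : kC, (forall P, regular_at P f) -> is_const f.

Context (u : kC) (n : nat).
Hypothesis n_ge2 : (2 <= n)%N.
Hypothesis deg_u : has_degree u n.

Context (r : nat) (a : 'I_r -> k).
Hypothesis a_inj : injective a.
Hypothesis a_branch : forall b, finite_branch_value u b <-> exists j, b = a j.

Context (e d : 'I_r -> nat) (F : 'I_r -> divisor C).
Context (einf dinf : nat) (Finf : divisor C).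
Hypothesis F_reduced : forall j, reduced_effective (F j).
Hypothesis F_fibre : forall j, is_fibre u (a j) (F j *+ e j).
Hypothesis F_deg : forall j, deg (F j) = (d j)%:Z.
Hypothesis ed : forall j, (e j * d j)%N = n.
Hypothesis Finf_reduced : reduced_effective Finf.
Hypothesis Finf_fibre : is_fibre_at_infty u (Finf *+ einf).
Hypothesis Finf_deg : deg Finf = dinf%:Z.
Hypothesis edinf : (einf * dinf)%N = n.
Hypothesis gcd_d : gcdn n (gcdn (\big[gcdn/0%N]_(j < r) d j) dinf) = 1%N.

Definition branch_prod (l : 'I_r -> int) : kC :=
  \prod_(j < r) (u - iota (a j)) ^ l j.

Let n_gt0 : (0 < n)%N. Proof. exact: ltnW. Qed.
Let nu : ~ is_const u. Proof. exact: has_degree_nonconst deg_u. Qed.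

Let e_gt0 j : (0 < e j)%N.
Proof. by have := ed j; case: (e j) => //; rewrite mul0n => n0; move: n_gt0; rewrite -n0. Qed.
Let d_gt0 j : (0 < d j)%N.
Proof. by have := ed j; case: (d j) => //; rewrite muln0 => n0; move: n_gt0; rewrite -n0. Qed.
Let einf_gt0 : (0 < einf)%N.
Proof. by have := edinf; case: (einf) => //; rewrite mul0n => n0; move: n_gt0; rewrite -n0. Qed.
Let dinf_gt0 : (0 < dinf)%N.
Proof. by have := edinf; case: (dinf) => //; rewrite muln0 => n0; move: n_gt0; rewrite -n0. Qed.

Let ua0 j : u - iota (a j) != 0. Proof. exact: sub_const_neq0. Qed.

(** Poles of [u] read as zeros of [u^-1], so that the facts on reduced fibres also serve at
    infinity. *)
Let Finf_fibreV P : coeff P (Finf *+ einf) = Num.max 0 (ord P u^-1).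
Proof. by rewrite Finf_fibre ordV. Qed.

Let zero_point j : exists P, P \in dom (F j).
Proof. exact: (reduced_point (F_reduced j) (F_deg j) (d_gt0 j)). Qed.

Let zero_ord j P : P \in dom (F j) -> ord P (u - iota (a j)) = e j.
Proof. exact: (reduced_ord (F_reduced j) (F_fibre j) (e_gt0 j)). Qed.

Let zero_dom j P : (P \in dom (F j)) = (0 < ord P (u - iota (a j))).
Proof. exact: (reduced_dom (F_reduced j) (F_fibre j) (e_gt0 j)). Qed.

Let pole_point : exists P, P \in dom Finf.
Proof. exact: (reduced_point Finf_reduced Finf_deg dinf_gt0). Qed.

Let pole_ord j P : P \in dom Finf -> ord P (u - iota (a j)) = - einf%:Z.
Proof.
move=> PD; have oV := reduced_ord Finf_reduced Finf_fibreV einf_gt0 PD.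
have oE : ord P u = - einf%:Z by rewrite -oV ordV opprK.
by rewrite ord_subC_pole oE // oppr_lt0 ltz_nat.
Qed.

Lemma branch_prod_neq0 l : branch_prod l != 0.
Proof.
apply: (big_ind (fun y => y != 0)) => [||j _]; first exact: oner_neq0.
  by move=> *; apply: mulf_neq0.
by rewrite expfz_neq0.
Qed.

Lemma ord_branch_prod P l :
  ord P (branch_prod l) = \sum_j l j * ord P (u - iota (a j)).
Proof.
rewrite ord_prod => [|j _]; last by rewrite expfz_neq0.
by apply: eq_bigr => j _; rewrite ordXz mulrC.
Qed.

Lemma ord_branch_prod_zero j P l : P \in dom (F j) ->
  ord P (branch_prod l) = l j * e j.
Proof.
move=> PD; rewrite ord_branch_prod (bigD1 j) //= big1 => [|i ij].
  by rewrite addr0 zero_ord.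
rewrite (@ord_sub_other _ _ u nu P (a j)) ?mulr0 //; first by rewrite -zero_dom.
by rewrite (inj_eq a_inj).
Qed.

Lemma ord_branch_prod_pole P l : P \in dom Finf ->
  ord P (branch_prod l) = - (\sum_j l j) * einf.
Proof.
move=> PD; rewrite ord_branch_prod mulNr mulr_suml -sumrN; apply: eq_bigr => j _.
by rewrite pole_ord // mulrN.
Qed.

Lemma branch_prod_ratfun l : ratfuns u (branch_prod l).
Proof.
suff /asboolP : branch_prod l \in adjoin_pred iota [:: u] by [].
apply: rpred_prod => j _; have aj : u - iota (a j) \in adjoin_pred iota [:: u].
  exact/asboolP/adjoin_sub_const.
by case: (l j) => m; rewrite ?NegzE -?exprnN ?rpredV rpredX.
Qed.

Let d_gcd (l : 'I_r -> int) := (forall j, gcdz n%:Z (l j) = (d j)%:Z) /\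
  gcdz n%:Z (\sum_(j < r) l j) = dinf%:Z.

(** Over [a j], [n * ord v = l j * e j], and [m * ord v] is a multiple of [e j] when [v ^+ m] is in
    [k(u)]; so [n] divides [m * l j]. Hence [n] divides [m * d j] for all [j] and, summing the
    [l j], also [m * dinf]. The gcd hypothesis leaves [n] dividing [m]. *)
Lemma power_ratfun l v m : d_gcd l -> v != 0 -> v ^+ n = branch_prod l ->
  ratfuns u (v ^+ m) -> (n %| m)%N.
Proof.
move=> [dl dS] v0 vn Evm.
have nl j : (n%:Z %| m%:Z * l j)%Z.
  have [P PD] := zero_point j.
  have oP : 0 < ord P (u - iota (a j)) by rewrite -zero_dom.
  have [t tE] := ord_ratfun nu oP Evm.
  have := congr1 (ord P) vn; rewrite (ord_branch_prod_zero _ PD) ordX => nE.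
  rewrite ordX (zero_ord PD) in tE.
  apply/dvdzP; exists t; have e0 : (e j)%:Z != 0 by rewrite eqz_nat -lt0n.
  apply: (mulIf e0); rewrite -mulrA -nE [RHS]mulrAC -tE.
  by rewrite -[_ *+ n]mulr_natr -[_ *+ m]mulr_natr !natz; ring.
have nS : (n%:Z %| m%:Z * \sum_j l j)%Z by rewrite mulr_sumr; apply: rpred_sum => j _; apply: nl.
have ngcd y : (n%:Z %| m%:Z * y)%Z -> (n%:Z %| m%:Z * gcdz n y)%Z.
  by move=> ny; rewrite (mulz_gcdr m%:Z) dvdz_gcd ny dvdz_mull.
have nd j : (n %| m * d j)%N.
  by have := ngcd _ (nl j); rewrite dl -PoszM.
have ndinf : (n %| m * dinf)%N by have := ngcd _ nS; rewrite dS -PoszM.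
have nbig : (n %| m * \big[gcdn/0%N]_(j < r) d j)%N.
  apply: (big_ind (fun y => n %| m * y)%N) => [|x y nx ny|j _]; last exact: nd.
    by rewrite muln0 dvdn0.
  by rewrite muln_gcdr dvdn_gcd nx ny.
have : (n %| m * gcdn n (gcdn (\big[gcdn/0%N]_(j < r) d j) dinf))%N.
  by rewrite !muln_gcdr !dvdn_gcd nbig ndinf dvdn_mull.
by rewrite gcd_d muln1.
Qed.

(** [f ^+ n] and the product have the same divisor, so their quotient is constant, and an [n]-th
    root of it is absorbed into [f]. *)
Lemma principal_root l D f : f != 0 -> is_div f D ->
  is_div (branch_prod l) (D *+ n) ->
  exists c, [/\ c != 0, (iota c * f) ^+ n = branch_prod l &
     f ^+ n = iota (c ^- n) * branch_prod l].
Proof.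
move=> f0 fD hD; have h0 := branch_prod_neq0 l.
have [|b bE] := complete (f := f ^+ n / branch_prod l).
  move=> P; apply/regular_ord; rewrite ordM ?expf_neq0 ?invr_eq0 // ordV ordX.
  by rewrite -hD -fD coeffMn subrr.
have fn : f ^+ n = iota b * branch_prod l by rewrite -bE divfK.
have b0 : b != 0.
  by apply: contraNneq (expf_neq0 n f0) => b0; rewrite fn b0 rmorph0 mul0r.
have [y yn] := closed_nth_root b n_gt0.
have y0 : y != 0.
  by apply: contraNneq b0 => y0; rewrite -yn y0 expr0n gtn_eqF.
exists y^-1; rewrite invr_eq0; split=> //.
  by rewrite exprMn fn -rmorphXn exprVn yn fmorphV mulKf ?fmorph_eq0.
by rewrite exprVn invrK yn.
Qed.

Let EP f : ratfuns u f <-> exists c, f = adjoin_emb c :> kC := adjoinP iota [:: u] f.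

Section Kummer.

Context (l : 'I_r -> int) (v : kC).
Hypothesis dl : d_gcd l.
Hypothesis v0 : v != 0.
Hypothesis vn : v ^+ n = branch_prod l.

Let kummer_data : exists z w : adjoin_field iota [:: u], [/\ n.-primitive_root z,
  v ^+ n = adjoin_emb w & forall m (y : adjoin_field iota [:: u]),
  v ^+ m = adjoin_emb y -> (n %| m)%N].
Proof.
have [z prim_z] := closed_prim_root char0 n_gt0.
have [y yE] : exists c : adjoin_field iota [:: u], iota z = adjoin_emb c.
  exact/adjoinP/adjoin_const.
have [w wE] := (EP _).1 (branch_prod_ratfun l).
exists y, w; split; last 1 first.
- by move=> m c vm; apply: (power_ratfun dl v0 vn); apply/EP; exists c.
- by rewrite -(fmorph_primitive_root adjoin_emb) /= -yE fmorph_primitive_root.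
- by rewrite vn.
Qed.

Lemma cyclic_cover_galois :
  is_galois (ratfuns u) /\ has_cyclic_aut_group (ratfuns u).
Proof.
have [z [w [prim_z vw pow]]] := kummer_data.
by split; [exact: (kummer_galois prim_z v0 vw pow EP deg_u) |
  exact: (kummer_cyclic prim_z v0 vw pow EP deg_u)].
Qed.

Lemma cyclic_cover_generated f : adjoin iota [:: u; v] f.
Proof.
have [z [w [prim_z vw pow]]] := kummer_data.
have [A _ ->] := kummer_span prim_z v0 vw pow EP deg_u f.
suff /asboolP : (map_poly adjoin_emb A).[v] \in adjoin_pred iota [:: u; v] by [].
rewrite horner_coef; apply: rpred_sum => i _; apply: rpredM; last first.
  by apply: rpredX; apply/asboolP/adjoin_gen; rewrite !inE eqxx orbT.
rewrite coef_map /=; apply/asboolP.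
have : adjoin iota [:: u] (adjoin_emb A`_i) by apply: adjoin_embP.
elim=> [c|s|f1 f2 _ IH1 _ IH2|f1 f2 _ IH1 _ IH2|f1 _ IH].
- exact: adjoin_const.
- by rewrite inE => /eqP ->; apply: adjoin_gen; rewrite !inE eqxx.
- exact: adjoin_sub.
- exact: adjoin_mul.
- exact: adjoin_inv.
Qed.

End Kummer.

Let ratfun_b b : adjoin iota [:: u] (u - iota b).
Proof. exact: adjoin_sub_const. Qed.

Section CyclicGenerator.

Context (s : {rmorphism kC -> kC}) (z : k) (v : kC).
Hypothesis s_fix : forall f, ratfuns u f -> s f = f.
Hypothesis prim_z : n.-primitive_root z.
Hypothesis v0 : v != 0.
Hypothesis sv : s v = iota z * v.

Let s_const c : s (iota c) = iota c.
Proof. exact/s_fix/adjoin_const. Qed.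

Let su : s u = u.
Proof. by apply/s_fix/adjoin_gen; rewrite inE. Qed.

(* Off the branch values, the exponents of [v^n] are multiples of [n]: there
   is an unramified point over each such value. *)
Lemma exponents_on_branch : ratfuns u (v ^+ n) ->
  exists (l : 'I_r -> int) v', [/\ v' != 0, s v' = iota z * v' &
    v' ^+ n = branch_prod l].
Proof.
move=> Evn; have vn0 : v ^+ n != 0 by rewrite expf_neq0.
have Ua : uniq (codom a) by apply/injectiveP.
have [c [U [m [Uu sub vnE]]]] := ratfun_factor nu Ua vn0 Evn.
have c0 : c != 0 by apply: contraNneq vn0 => c0; rewrite vnE c0 rmorph0 mul0r.
have nm b : b \in U -> b \notin codom a -> (n%:Z %| m b)%Z.
  move=> bU ba; have [P oP] := exists_zero nu b complete.
  have oP1 : ord P (u - iota b) = 1.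
    have : ~ (1 < ord P (u - iota b)).
      move=> o1; case/negP: ba; apply/codomP; apply/a_branch.
      by exists P.
    exact: gt0_le1.
  have := congr1 (ord P) vnE; rewrite ordX ordM ?fmorph_eq0 //; last first.
    apply: (big_ind (fun y => y != 0)) => [||b' _]; first exact: oner_neq0.
      by move=> *; apply: mulf_neq0.
    by rewrite expfz_neq0 // sub_const_neq0.
  rewrite ord_const add0r ord_prod => [|b' _]; last first.
    by rewrite expfz_neq0 // sub_const_neq0.
  rewrite (bigD1_seq b) //= big1 => [|b' b'b]; last first.
    by rewrite ordXz (ord_sub_other nu oP b'b) mul0r.
  rewrite ordXz oP1 addr0 mul1r => <-.
  by rewrite -mulr_natr natz dvdz_mull.
have [y yn] := closed_nth_root c n_gt0.
have y0 : y != 0 by apply: contraNneq c0 => y0; rewrite -yn y0 expr0n gtn_eqF.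
(* An exact [n]-th root of the unramified part; it lies in [k(u)], so dividing [v] by it preserves
   the eigenvalue. *)
pose q := iota y * \prod_(b <- U | b \notin codom a) (u - iota b) ^ (m b %/ n%:Z)%Z.
have q0 : q != 0.
  rewrite mulf_neq0 ?fmorph_eq0 //.
  apply: (big_ind (fun y => y != 0)) => [||b' _]; first exact: oner_neq0.
    by move=> *; apply: mulf_neq0.
  by rewrite expfz_neq0 // sub_const_neq0.
have Eq : ratfuns u q.
  suff /asboolP : q \in adjoin_pred iota [:: u] by [].
  apply: rpredM; first exact/asboolP/adjoin_const.
  apply: rpred_prod => b _; have ub : u - iota b \in adjoin_pred iota [:: u].
    exact/asboolP/ratfun_b.
  by case: (_ %/ _)%Z => j; rewrite ?NegzE -?exprnN ?rpredV rpredX.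
have qn : q ^+ n = iota c * \prod_(b <- U | b \notin codom a) (u - iota b) ^ m b.
  rewrite exprMn -rmorphXn yn -prodrXl; congr (_ * _).
  rewrite big_seq_cond [RHS]big_seq_cond; apply: eq_bigr => b /andP [bU ba].
  by rewrite exprnP exprz_exp divzK // nm.
exists (fun j => m (a j)), (v / q); split.
- by rewrite mulf_neq0 ?invr_eq0.
- by rewrite fmorph_div sv (s_fix Eq) mulrA.
rewrite expr_div_n qn vnE (bigID (fun b => b \in codom a)) /=.
rewrite mulrCA mulrK; last first.
  by rewrite -qn unitfE expf_neq0.
rewrite -big_filter (perm_big (codom a)) /=; last first.
  apply: uniq_perm; rewrite ?filter_uniq // => b.
  by rewrite mem_filter; case: (boolP (b \in codom a)) => // /sub ->.
by rewrite /codom /image_mem big_map big_enum.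
Qed.

Section Exponents.

Context (l : 'I_r -> int).
Hypothesis vn : v ^+ n = branch_prod l.

(** At a point over [a j], [n * ord v = l j * e j] and [n = e j * d j]. *)
Lemma zero_exponent_dvd j : exists m, l j = m * (d j)%:Z.
Proof.
have [P PD] := zero_point j; exists (ord P v).
have e0 : (e j)%:Z != 0 by rewrite eqz_nat -lt0n.
apply: (mulIf e0); rewrite -(ord_branch_prod_zero l PD) -vn ordX.
by rewrite -mulrA -PoszM mulnC ed -mulr_natr natz.
Qed.

Lemma pole_exponent_dvd : exists m, \sum_j l j = m * dinf%:Z.
Proof.
have [P PD] := pole_point; exists (- ord P v).
have e0 : einf%:Z != 0 by rewrite eqz_nat -lt0n.
apply: (mulIf e0); apply: oppr_inj; rewrite -[LHS]mulNr.
rewrite -(ord_branch_prod_pole l PD) -vn ordX.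
by rewrite -mulrA -PoszM mulnC edinf -mulr_natr natz mulNr opprK.
Qed.

(** Divisibility by [d j] gives one inequality; [card_fibre_ge], applied to the [d j] points of the
    fibre, gives the other. *)
Lemma zero_exponent_gcd j : gcdz n%:Z (l j) = (d j)%:Z.
Proof.
have side i : i != j -> ('X - (a i)%:P).[a j] != 0.
  by rewrite hornerXsubC subr_eq0 eq_sym (inj_eq a_inj).
have [p [q [pb qb pqE]]] := prod_peval_frac u l side.
have le_d : (gcdn n `|l j| <= size (dom (F j)))%N.
  apply: (card_fibre_ge complete nu s_const su prim_z v0 sv _ _ pb qb _
      (T := dom (F j)) (S := flatten (nseq einf (dom Finf))) (u := u)).
  - by move=> P; rewrite (reduced_fibre_list Finf_reduced Finf_fibreV) ordV.
  - by rewrite (reduced_fibre_size einf Finf_reduced Finf_deg).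
  - rewrite vn /branch_prod (bigD1 j) //= -pqE; congr (_ * _).
    by apply: eq_bigr => i _; rewrite pevalXsubC.
  - exact: zero_dom.
  - by have [P] := zero_point j; case: (dom _).
have [m lE] := zero_exponent_dvd j.
congr Posz; apply/eqP; rewrite eqn_leq (leq_trans le_d) /=; last first.
  by rewrite (reduced_deg (F_reduced j) (F_deg j)).
apply: dvdn_leq; first by rewrite gcdn_gt0 n_gt0.
rewrite dvdn_gcd lE abszM dvdn_mull // andbT; apply/dvdnP.
by exists (e j); rewrite ed.
Qed.

(* The same count, with [1 / (u - a_j)] as coordinate. *)
Lemma pole_exponent_gcd (j : 'I_r) : gcdz n%:Z (\sum_j l j) = dinf%:Z.
Proof.
pose t := (u - iota (a j))^-1.
have nt : ~ is_const t.
  move=> [c tc]; apply: nu; exists (c^-1 + a j).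
  by rewrite rmorphD fmorphV -tc invrK subrK.
have t0 : t != 0 by rewrite invr_eq0.
(* [u - a i = t^-1 * (1 + (a j - a i) t)], so in terms of [t] the product has exponent minus the sum
   of the [l i], with cofactors of value 1 at [t = 0]. *)
pose ri i : {poly k} := 1 + (a j - a i)%:P * 'X.
have side i : true -> (ri i).[0] != 0.
  by rewrite /ri !hornerE oner_neq0.
have [p [q [pb qb pqE]]] := prod_peval_frac t l side.
have le_d : (gcdn n `|- (\sum_j l j)| <= size (dom Finf))%N.
  apply: (card_fibre_ge complete nt s_const _ prim_z v0 sv _ _ pb qb _
      (T := dom Finf) (S := flatten (nseq (e j) (dom (F j)))) (u := t)).
  - by rewrite /t fmorphV (s_fix (ratfun_b _)).
  - by move=> P; rewrite (reduced_fibre_list (F_reduced j) (F_fibre j)) /t ordV opprK.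
  - by rewrite (reduced_fibre_size (e j) (F_reduced j) (F_deg j)) ed.
  - rewrite vn /branch_prod -pqE rmorph0 subr0 -invr_expz.
    have -> : (t ^ (\sum_j l j))^-1 = \prod_i (t ^ l i)^-1.
      elim/big_rec2: _ => [|i x y _ E]; first by rewrite expr0z invr1.
      by rewrite expfzDr // invfM E.
    rewrite -big_split; apply: eq_bigr => i _ /=.
    rewrite /ri rmorphD rmorph1 rmorphM /= pevalC pevalX.
    rewrite invr_expz -exprz_inv -expfzMl /t invrK; congr (_ ^ _).
    rewrite mulrDr mulr1 mulrCA divff // mulr1 rmorphB; ring.
  - move=> P; rewrite (reduced_dom Finf_reduced Finf_fibreV einf_gt0).
    rewrite rmorph0 subr0 /t !ordV !oppr_gt0.
    by rewrite pole_subC.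
  - by have [P] := pole_point; case: (dom _).
have [m lE] := pole_exponent_dvd; rewrite abszN in le_d.
congr Posz; apply/eqP; rewrite eqn_leq (leq_trans le_d) /=; last first.
  by rewrite (reduced_deg Finf_reduced Finf_deg).
apply: dvdn_leq; first by rewrite gcdn_gt0 n_gt0.
rewrite dvdn_gcd lE abszM dvdn_mull // andbT; apply/dvdnP.
by exists einf; rewrite edinf.
Qed.

(** Provides the branch value that the coordinate at infinity is built on. With none, [v ^+ n = 1]
    would make [v] constant, hence fixed by [s], against [z != 1]. *)
Lemma exponents_index : 'I_r.
Proof.
case: (pickP (fun _ : 'I_r => true)) => [j //|no]; exfalso.
have v1 : v ^+ n = 1 by rewrite vn /branch_prod big1 // => j; have := no j.
have [c vc] : is_const v.
  apply: closed_algebraic; exists ('X^n - 1).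
    by rewrite -size_poly_eq0 -polyC1 size_XnsubC.
  by rewrite rmorphB /= map_polyXn rmorph1 /root !hornerE v1 subrr.
have := sv; rewrite vc s_const => /eqP; rewrite -{1}[iota c]mul1r.
rewrite (inj_eq (mulIf _)) -?vc // -(rmorph1 iota) (inj_eq (fmorph_inj _)).
rewrite eq_sym => /eqP z1; have := prim_z; rewrite z1 => prim1.
by have := prim_order_dvd prim1 1; rewrite expr1 eqxx dvdn1; case: n n_ge2 => [|[]].
Qed.

Lemma exponents_divisor : exists D,
  is_div v D /\ is_div (branch_prod l) (D *+ n).
Proof.
have /choice [m lE] : forall j, exists m, l j = m * (d j)%:Z := zero_exponent_dvd.
have [M SE] := pole_exponent_dvd.
(* The divisor of [u - a j] is [e j] times [F j] minus [einf] times [Finf]. These weights are right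
   because [n * m j = l j * e j] and [n * M] is [einf] times the sum of the [l j]. *)
pose D : divisor C := \sum_j F j *~ m j - Finf *~ M.
have vD : is_div v D.
  move=> P; have n0 : n%:Z != 0 by rewrite eqz_nat -lt0n.
  apply: (mulIf n0); have -> : ord P v * n = ord P (v ^+ n).
    by rewrite ordX -mulr_natr natz.
  rewrite vn ord_branch_prod /D coeffB raddf_sum /= raddfMz mulrBl mulr_suml.
  have cE j : coeff P (F j) * (e j)%:Z = Num.max 0 (ord P (u - iota (a j))).
    by rewrite -(F_fibre j) coeffMn -mulr_natr natz.
  have cinfE : coeff P Finf * einf%:Z = Num.max 0 (- ord P u).
    by rewrite -(Finf_fibre P) coeffMn -mulr_natr natz.
  have -> : coeff P Finf *~ M * n%:Z = \sum_j l j * Num.max 0 (- ord P u).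
    rewrite -mulr_suml SE -cinfE -edinf PoszM -mulrzr intz; ring.
  rewrite -sumrB; apply: eq_bigr => j _; rewrite raddfMz -mulrzr intz.
  rewrite -{1}(ed j) PoszM lE -(pole_part_sub u P (a j)).
  have -> : coeff P (F j) * m j * ((e j)%:Z * (d j)%:Z) =
      m j * (d j)%:Z * (coeff P (F j) * (e j)%:Z) by ring.
  rewrite cE -mulrBr; congr (_ * _).
  by rewrite max0B.
exists D; split=> // P; rewrite coeffMn vD -ordX vn.
by [].
Qed.

End Exponents.

End CyclicGenerator.

Lemma cyclic_exponents : is_galois (ratfuns u) -> has_cyclic_aut_group (ratfuns u) ->
  exists l D, [/\ forall j, gcdz n%:Z (l j) = (d j)%:Z,
        gcdz n%:Z (\sum_(j < r) l j) = dinf%:Z,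
        is_div (branch_prod l) (D *+ n)
      & principal D].
Proof.
move=> galu cycu.
have [s [z [v [[_ s_fix] prim_z v0 sv fixE]]]] := kummer_generator
  (fun m => closed_prim_root char0) EP (adjoin_const iota [:: u]) deg_u galu cycu.
have Evn : ratfuns u (v ^+ n).
  apply: fixE; rewrite (eigenX n sv) (prim_expr_order prim_z) rmorph1.
  exact: mul1r.
have [l [v' [v0' sv' vn]]] := exponents_on_branch s_fix v0 sv Evn.
have [D [vD hD]] := exponents_divisor vn.
exists l, D; split=> //.
- exact: (zero_exponent_gcd s_fix prim_z v0' sv' vn).
- exact: (pole_exponent_gcd s_fix prim_z v0' sv' vn
    (exponents_index s_fix prim_z v0' sv' vn)).
- by exists v'.
Qed.

End CyclicCover.

Theorem proposition5p6
  (k : closedFieldType) (char0 : [pchar k] =i pred0)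
  (C : smooth_projective_curve k)
  (g : nat) (genus_g : has_genus C g) (g_ge2 : (2 <= g)%N)
  (u : funfield C) (n : nat) (n_ge2 : (2 <= n)%N) (deg_u : has_degree u n)
  (r : nat) (a : 'I_r -> k) (a_inj : injective a)
  (a_branch : forall b, finite_branch_value u b <-> exists j, b = a j)
  (e d : 'I_r -> nat) (F : 'I_r -> divisor C)
  (einf dinf : nat) (Finf : divisor C)
  (F_reduced : forall j, reduced_effective (F j))
  (F_fibre : forall j, is_fibre u (a j) (F j *+ e j))
  (F_deg : forall j, deg (F j) = (d j)%:Z)
  (ed : forall j, (e j * d j)%N = n)
  (Finf_reduced : reduced_effective Finf)
  (Finf_fibre : is_fibre_at_infty u (Finf *+ einf))
  (Finf_deg : deg Finf = dinf%:Z)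
  (edinf : (einf * dinf)%N = n)
  (gcd_d : gcdn n (gcdn (\big[gcdn/0%N]_(j < r) d j) dinf) = 1%N) :
  let h (l : 'I_r -> int) := \prod_(j < r) (u - const C (a j)) ^ (l j) in
  let admissible (l : 'I_r -> int) (D : divisor C) :=
    [/\ forall j, gcdz n%:Z (l j) = (d j)%:Z,
        gcdz n%:Z (\sum_(j < r) l j) = dinf%:Z,
        is_div (h l) (D *+ n)
      & principal D] in
  ((is_galois (ratfuns u) /\ has_cyclic_aut_group (ratfuns u)) <->
   (exists l D, admissible l D)) /\
  (forall l D v, admissible l D -> spans v (RRspace (- D)) ->
     (exists2 c : k, c != 0 & v ^+ n = const C c * h l) /\
     (forall f, adjoin (const C) [:: u; v] f)).
Proof.
move=> h admissible; have n_gt0 : (0 < n)%N by apply: ltnW.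
have complete (f : funfield C) : (forall P, regular_at P f) -> is_const f.
  exact: (genus_regular_const genus_g).
split; [split|].
- move=> [galu cycu]; apply: (cyclic_exponents char0 complete n_ge2 deg_u
    a_inj a_branch F_reduced F_fibre F_deg ed Finf_reduced Finf_fibre Finf_deg
    edinf galu cycu).
- move=> [l [D [dl dS hD [f f0 fD]]]].
  have [c [c0 fn _]] := principal_root complete n_ge2 deg_u f0 fD hD.
  have v0 : const C c * f != 0 by rewrite mulf_neq0 ?fmorph_eq0.
  exact: (cyclic_cover_galois char0 n_ge2 deg_u a_inj F_reduced F_fibre
    F_deg ed gcd_d (conj dl dS) v0 fn).
move=> l D v [dl dS hD [f f0 fD]] spv.
have [c [c0 fn fnE]] := principal_root complete n_ge2 deg_u f0 fD hD.
(* As [D] is the divisor of [f], the function [f] itself lies in [L(-D)]. *)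
have [b fE] : exists b, f = const C b * v.
  by apply/spv; right=> P; rewrite -fD coeffN subrr.
have b0 : b != 0 by apply: contraNneq f0 => b0; rewrite fE b0 rmorph0 mul0r.
have v0 : v != 0 by apply: contraNneq f0 => v0; rewrite fE v0 mulr0.
split.
  exists ((c * b) ^- n); first by rewrite invr_eq0 expf_neq0 ?mulf_neq0.
  move: fn; rewrite fE mulrA -rmorphM exprMn -rmorphXn => E.
  rewrite fmorphV; apply: (mulfI (_ : const C ((c * b) ^+ n) != 0)).
    by rewrite fmorph_eq0 expf_neq0 ?mulf_neq0.
  by rewrite E mulVKf // fmorph_eq0 expf_neq0 ?mulf_neq0.
have w0 : const C c * f != 0 by rewrite mulf_neq0 ?fmorph_eq0.
(* Generation is known for the normalized root [c * f], a constant multiple of [v]. *)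
move=> y; have := cyclic_cover_generated char0 n_ge2 deg_u a_inj F_reduced
  F_fibre F_deg ed gcd_d (conj dl dS) w0 fn y.
elim=> [b'|y'|y1 y2 _ IH1 _ IH2|y1 y2 _ IH1 _ IH2|y1 _ IH].
- exact: adjoin_const.
- rewrite !inE => /orP [/eqP ->|/eqP ->]; first by apply: adjoin_gen; rewrite inE eqxx.
  rewrite fE; apply: adjoin_mul; first exact: adjoin_const.
  apply: adjoin_mul; first exact: adjoin_const.
  by apply: adjoin_gen; rewrite !inE eqxx orbT.
- exact: adjoin_sub.
- exact: adjoin_mul.
- exact: adjoin_inv.
Qed.
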